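(* Let $S$ be a surface of revolution in $\mathbb R^3$ such that every line through the origin intersects $S$ transversally. Let $v$ be a divergence free vector field on $S$, $p\in S$, and let $v$ be extended to a neighborhood of $p$ in $\mathbb R^3$ (extension still denoted $v$) so that it is divergence free on $\mathbb R^3$. Then $$\begin{aligned}\iota_S^*\{-\triangle v^\flat\}&=-\triangle_S(\iota_S^*v^\flat)-\iota_S^*\{\mathcal L_N\mathcal L_Nv^\flat\}+(\kappa_1-\kappa_2)\,\iota_S^*\{\mathcal L_Nv^\flat\}+\frac1{|\nabla\rho|^2}\iota_S^*\{\mathcal L_Yv^\flat\}\\&\quad+2(\kappa_2-\kappa_1)(\mathcal L_Nv^\flat)_1E^1-2\left(\frac{E_1(|\nabla\rho|)}{|\nabla\rho|}\right)^2v_1E^1 .\end{aligned}$$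
   Context: Surface of revolution: let $C$ be a smooth embedded 1-dimensional submanifold of $\{(r,z):r>0,\ z\in\mathbb R\}$; $S=\{(x,y,z):(\sqrt{x^2+y^2},z)\in C\}$ with the metric induced from $\mathbb R^3$. Near $p\in S$, let $\gamma(t)=(a(t),b(t))$, $t\in I$ ($I$ an open interval), be a local unit speed parametrization of $C$ ($a>0$, $\dot a^2+\dot b^2=1$) and $$\Phi(\rho,t,\theta)=(\rho a(t)\cos\theta,\rho a(t)\sin\theta,\rho b(t)),\qquad \rho>0.$$ The transversality assumption is equivalent to $b\dot a-a\dot b\neq0$, so that $(\rho,t,\theta)$ are local coordinates on $\mathbb R^3$ near $p$ (after a rotation in $\theta$ if needed), and $S$ is locally $\{\rho=1\}$; $\rho$ is the local defining function. Frame near $p$ in $\mathbb R^3$: $E_1=\partial_t/\rho$ (unit, along the meridians on $S$), $E_2=\partial_\theta/(a\rho)$, $E_3=N=\nabla\rho/|\nabla\rho|$ (Euclidean gradient and norm); this is an orthonormal frame, and on $S$, $E_1,E_2$ are tangent and are eigenvectors of the shape operator $sX=-\tilde\nabla_XN$ ($\tilde\nabla$ the Euclidean connection), with principal curvatures $sE_1=\kappa_1E_1$, $sE_2=\kappa_2E_2$. $E^1$ is the 1-form on $S$ dual to $E_1$. $Y=|\nabla\rho|\,E_1(|\nabla\rho|)\,E_1$. $\iota_S:S\hookrightarrow\mathbb R^3$ is the inclusion and $\iota_S^*$ its pullback; $v^\flat$ is the 1-form metrically dual to $v$; $\mathcal L$ is the Lie derivative; for a 1-form $\omega$, $\omega_1=\omega(E_1)$,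 so $(\mathcal L_Nv^\flat)_1=(\mathcal L_Nv^\flat)(E_1)$ and $v_1=v^\flat(E_1)$. $-\triangle=dd^*+d^*d$ and $-\triangle_S=dd^*+d^*d$ are the (nonnegative) Hodge Laplacians on 1-forms of $\mathbb R^3$ and of $S$. The identity is between 1-forms on $S$, near $p$; coefficients are evaluated on $S$. ''Divergence free on $\mathbb R^3$'' means on the neighborhood where the extension is defined. *)

(* Defs.v *)
From mathcomp Require Import all_boot all_order all_algebra.
From mathcomp Require Import all_classical all_reals all_analysis.

Set Implicit Arguments.
Unset Strict Implicit.
Unset Printing Implicit Defensive.

Import Order.TTheory GRing.Theory Num.Theory.
Import numFieldNormedType.Exports.

Local Open Scope classical_set_scope.
Local Open Scope ring_scope.

(* The source is meant to be finite-dimensional and U open; then Ck k U f says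
   that f is of class C^k on U. *)
Fixpoint Ck (R : realType) (V W : normedModType R) (k : nat) (U : set V)
    (f : V -> W) : Prop :=
  match k with
  | 0%N => forall x, U x -> {for x, continuous f}
  | k'.+1 => (forall x, U x -> differentiable f x) /\
             forall h : V, Ck k' U (fun x => 'D_h f x)
  end.

Definition smooth (R : realType) (V W : normedModType R) (U : set V)
  (f : V -> W) : Prop := forall k, Ck k U f.

(* Tensor calculus in coordinates. On an open subset of R^n, a vector field
   and a 1-form are both given by their row of components, a 2-form by the
   antisymmetric matrix of its components, and a Riemannian metric by its
   matrix. *)
Section Tensors.
Context {R : realType} {n : nat}.
Implicit Types (g : 'rV[R]_n -> 'M[R]_n) (X : 'rV[R]_n -> 'rV[R]_n).
Implicit Types (w : 'rV[R]_n -> 'rV[R]_n) (f : 'rV[R]_n -> R).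

Definition dot (u v : 'rV[R]_n) : R := \sum_i u 0 i * v 0 i.

(* The library norm on 'rV[R]_n is the sup norm. *)
Definition enorm (u : 'rV[R]_n) : R := Num.sqrt (dot u u).

Definition partial (i : 'I_n) f (x : 'rV[R]_n) : R := 'D_(delta_mx 0 i) f x.

Definition grad f (x : 'rV[R]_n) : 'rV[R]_n := \row_i partial i f x.

Definition euclid : 'rV[R]_n -> 'M[R]_n := fun=> 1%:M.

Definition flat g X : 'rV[R]_n -> 'rV[R]_n := fun x => X x *m g x.

Definition sharp g w : 'rV[R]_n -> 'rV[R]_n := fun x => w x *m invmx (g x).

Definition form_eval (w1 u : 'rV[R]_n) : R := \sum_i w1 0 i * u 0 i.

Definition vol g (x : 'rV[R]_n) : R := Num.sqrt (\det (g x)).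

Definition divergence g X (x : 'rV[R]_n) : R :=
  (vol g x)^-1 * \sum_i partial i (fun y => vol g y * X y 0 i) x.

Definition d0 f : 'rV[R]_n -> 'rV[R]_n := fun x => \row_i partial i f x.

Definition d1 w : 'rV[R]_n -> 'M[R]_n := fun x =>
  \matrix_(i, j) (partial i (fun y => w y 0 j) x
                  - partial j (fun y => w y 0 i) x).

(* codiff1 and codiff2 are the formal adjoints d^* of d0 and d1 for the L^2
   products defined by g; on 2-forms the pointwise product is
   1/2 B_ij B'^ij, so that (d^* B)^k = - vol^-1 d_i (vol B^ik). *)
Definition codiff1 g w (x : 'rV[R]_n) : R := - divergence g (sharp g w) x.

Definition codiff2 g (B : 'rV[R]_n -> 'M[R]_n) : 'rV[R]_n -> 'rV[R]_n :=
  flat g (fun x => \row_k (- ((vol g x)^-1 *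
    \sum_i partial i
      (fun y => vol g y * (invmx (g y) *m B y *m invmx (g y)) i k) x))).

Definition hodge_laplacian g w : 'rV[R]_n -> 'rV[R]_n := fun x =>
  d0 (codiff1 g w) x + codiff2 g (d1 w) x.

Definition lie_form X w : 'rV[R]_n -> 'rV[R]_n := fun x =>
  \row_j \sum_i (X x 0 i * partial i (fun y => w y 0 j) x
                 + w x 0 i * partial j (fun y => X y 0 i) x).

End Tensors.

Definition pullback (R : realType) (m n : nat) (F : 'rV[R]_m -> 'rV[R]_n)
    (w : 'rV[R]_n -> 'rV[R]_n) : 'rV[R]_m -> 'rV[R]_m :=
  fun y => \row_i form_eval (w (F y)) ('D_(delta_mx 0 i) F y).

Definition induced_metric (R : realType) (m n : nat)
    (F : 'rV[R]_m -> 'rV[R]_n) : 'rV[R]_m -> 'M[R]_m :=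
  fun y => \matrix_(i, j)
    dot ('D_(delta_mx 0 i) F y) ('D_(delta_mx 0 j) F y).

Section SurfaceOfRevolution.
Context {R : realType}.
Implicit Types (C : set (R * R)) (I : set R) (a b : R -> R).
Implicit Types (S : set 'rV[R]_3) (p q u : 'rV[R]_3).

Definition row3 (x y z : R) : 'rV[R]_3 := \row_(i < 3) [:: x; y; z]`_i.

(* The last condition makes t |-> (a t, b t) a homeomorphism from I onto an
   open subset of C. *)
Definition local_param C I a b : Prop :=
  [/\ open I /\ is_interval I,
      smooth I a /\ smooth I b,
      forall t, I t -> derive1 a t != 0 \/ derive1 b t != 0,
      forall s t, I s -> I t -> a s = a t -> b s = b t -> s = t
    & forall J : set R, open J -> J `<=` I -> exists O : set (R * R),
        open O /\ [set (a t, b t) | t in J] = C `&` O].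

Definition embedded_curve C : Prop :=
  (forall c, C c -> 0 < c.1) /\
  forall c, C c -> exists I a b t,
    [/\ local_param C I a b, I t & c = (a t, b t)].

Definition unit_speed I a b : Prop :=
  forall t, I t -> derive1 a t ^+ 2 + derive1 b t ^+ 2 = 1.

Definition profile q : R * R :=
  (Num.sqrt ((q 0 0) ^+ 2 + (q 0 1) ^+ 2), q 0 2).

Definition surface C : set 'rV[R]_3 := [set q | C (profile q)].

Definition tangent S q u : Prop :=
  exists (e : R) (c : R -> 'rV[R]_3),
    [/\ 0 < e, smooth `]-e, e[%classic c,
        forall s, -e < s < e -> S (c s), c 0 = q & derive1 c 0 = u].

(* A line through the origin that misses S, such as the axis of revolution,
   is transversal to S. *)
Definition transversal_lines S : Prop :=
  forall u, u != 0 -> forall q, S q -> (exists s : R, q = s *: u) ->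
  forall w : 'rV[R]_3, exists (s : R) (x : 'rV[R]_3),
    tangent S q x /\ w = s *: u + x.

(* The point c has coordinates (rho, t, theta) = (c 0 0, c 0 1, c 0 2). *)
Definition Phi a b (c : 'rV[R]_3) : 'rV[R]_3 :=
  row3 (c 0 0 * a (c 0 1) * cos (c 0 2))
       (c 0 0 * a (c 0 1) * sin (c 0 2))
       (c 0 0 * b (c 0 1)).

(* The local coordinates (t, theta) of the surface {rho = 1}. *)
Definition chart a b (y : 'rV[R]_2) : 'rV[R]_3 :=
  Phi a b (row3 1 (y 0 0) (y 0 1)).

(* The charts attached to the local parametrizations of C form an atlas of
   the surface, once restricted to theta-intervals of length < 2 pi. *)
Definition surface_vector_field C (v : 'rV[R]_3 -> 'rV[R]_3) : Prop :=
  (forall q, surface C q -> tangent (surface C) q (v q)) /\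
  forall I a b, local_param C I a b ->
    smooth [set y : 'rV[R]_2 | I (y 0 0)] (v \o chart a b).

(* sharp (pullback (flat v)) is the component row of v in the chart. *)
Definition surface_divergence_free C (v : 'rV[R]_3 -> 'rV[R]_3) : Prop :=
  forall I a b, local_param C I a b -> forall y : 'rV[R]_2, I (y 0 0) ->
    let g := induced_metric (chart a b) in
    divergence g (sharp g (pullback (chart a b) (flat euclid v))) y = 0.

(* The coordinates (rho, t, theta) of q. When b a' - a b' has no zero on the
   interval I, it has constant sign, b / a is strictly monotone on I, hence
   rho and t are unique and theta is unique modulo 2 pi; the choice of theta
   does not affect the fields E1 and E2 below. *)
Definition coords I a b q : 'rV[R]_3 :=
  get [set c : 'rV[R]_3 | [/\ 0 < c 0 0, I (c 0 1) & Phi a b c = q]].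

Definition rho I a b q : R := coords I a b q 0 0.

Definition E1 I a b q : 'rV[R]_3 :=
  (rho I a b q)^-1 *: 'D_(delta_mx 0 1) (Phi a b) (coords I a b q).

Definition E2 I a b q : 'rV[R]_3 :=
  (a (coords I a b q 0 1) * rho I a b q)^-1 *:
    'D_(delta_mx 0 2) (Phi a b) (coords I a b q).

Definition grad_norm I a b q : R := enorm (grad (rho I a b) q).

Definition Nfield I a b q : 'rV[R]_3 :=
  (grad_norm I a b q)^-1 *: grad (rho I a b) q.

Definition shape_operator I a b q u : 'rV[R]_3 := - 'D_u (Nfield I a b) q.

Definition E1_grad_norm I a b q : R := 'D_(E1 I a b q) (grad_norm I a b) q.

Definition Yfield I a b q : 'rV[R]_3 :=
  (grad_norm I a b q * E1_grad_norm I a b q) *: E1 I a b q.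

End SurfaceOfRevolution.

(* Main.v *)
Require Import Defs.
From mathcomp Require Import all_boot all_order all_algebra.
From mathcomp Require Import all_classical all_reals all_analysis.
From mathcomp Require Import ring lra.

(** Write [w] for the 1-form of [v], [omega = d w], [N] for the unit normal field,
    [T], [E] for the unit meridian and parallel fields on [S], [nu = |grad rho|]
    and [kappa = E1 (nu) / nu]. The identity is tested against [u = T] and
    [u = E].

    As [v] is divergence free both in space and along [S], each Laplacian is
    [d^*] of an exterior derivative. In the frame [(T, E, N)] the one in space
    is minus the sum of the [(D_e omega) (e, u)] over the frame [e]
    ([hodge_space]). The one on [S] differentiates the single function
    [omega (T, E)] ([hodge_surface]); this yields the same terms with [e = T]
    and [e = E], and products of [omega] with a principal curvature, because
    the frame turns ([meridian_curvature], [parallel_curvature]). It remains to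
    express [(D_N omega) (N, u)].

    By Cartan's formula [L_N w] is the sum of [omega (N, _)] and [d f], where
    [f = w (N)]. Applying it once more, [L_N L_N w] is the sum of
    [d (omega (N, _)) (N, _)] and [d (N f)] ([lie_form_twice]; symmetry of
    second derivatives gives [d d f = 0]). The first summand, at [u], is
    [(D_N omega) (N, u) + omega (D_N N, u) - omega (D_u N, N)]. Here [D_u N] is
    minus a principal curvature times [u], and [D_N N = kappa T], because the
    Hessian of [rho] is symmetric ([unit_gradient_derive],
    [derive_normal_normal]). In the second summand [f] vanishes on [S], but
    [N f] does not: comparing the two divergences shows that
    [<D_N v, N> = 0] on [S], so that [N f = <v, D_N N> = kappa w (T)] there
    ([derive_normal_part]).

    Finally [Y = nu^2 kappa E1]. Cartan's formula shows that
    [nu^-2 (L_Y w) (u)] is [kappa omega (T, u) + d (kappa w (E1)) (u)], which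
    cancels the two extra terms of [L_N L_N w], plus
    [2 kappa^2 w (T) <T, u>], which is the last correction in the statement
    ([lie_Y]).

    The fields have to be differentiated twice, so their smoothness must be
    proved. A curve in [S] near a point of the chart runs in the chart, and
    therefore tangent vectors are orthogonal to the chart normal
    ([tangent_normal]); transversality then gives [b a' - a b' <> 0]
    ([transversal_det]). Hence [b / a] has a smooth inverse, [t] is its value
    at [z / r], and [rho], [E1], [nu], [N] are smooth on an open cone. Their
    derivatives are obtained by differentiating along the coordinates
    [(rho, t, theta)]. *)

Set Implicit Arguments.
Unset Strict Implicit.
Unset Printing Implicit Defensive.

Import Order.TTheory GRing.Theory Num.Theory.
Import numFieldNormedType.Exports.
Local Open Scope classical_set_scope.
Local Open Scope ring_scope.

(** * Derivatives and the symmetry of second derivatives *)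

Section Calculus.
Context {R : realType}.
Implicit Types V W : normedModType R.

Lemma near_eq_differentiable V W (f g : V -> W) (x : V) :
  (\forall y \near x, f y = g y) -> differentiable f x -> differentiable g x.
Proof.
move=> fg df; have fgx := nbhs_singleton fg.
have := diff_locally df => /eqaddoP H.
have E : g \o shift x = cst (g x) + 'd f x +o_ (0 : V) id.
  apply/eqaddoP => e e0; have := H _ e0.
  have : \forall y \near (0 : V), f (y + x) = g (y + x).
    by have := fg; rewrite (near_shift 0) /= subr0.
  by apply: filterS2 => y; rewrite !fctE /= => -> ; rewrite fgx.
have dE : 'd g x = 'd f x :> (V -> W).
  by apply: (@diff_unique _ _ _ g ('d f x) x (diff_continuous df)); exact: E.
by apply/diff_locallyP; rewrite dE; split => //; exact: diff_continuous.
Qed.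

Lemma derive_chain V V' W (f : V -> V') (g : V' -> W) x h :
  differentiable f x -> differentiable g (f x) ->
  'D_h (g \o f) x = 'D_('D_h f x) g (f x).
Proof.
move=> df dg; rewrite (deriveE _ (differentiable_comp df dg)) (diff_comp df dg).
by rewrite (deriveE _ dg) (deriveE _ df).
Qed.

Lemma differentiable_mxP V m n (F : V -> 'M[R]_(m, n)) x :
  differentiable F x <-> forall i j, differentiable (fun y => F y i j) x.
Proof.
split=> [dF i j|dF].
  exact: (differentiable_comp dF (differentiable_coord (F x) i j)).
have -> : F = \sum_(i < m) \sum_(j < n) (fun y => F y i j *: delta_mx i j).
  apply/funext => y; rewrite [LHS]matrix_sum_delta fct_sumE.
  by apply: eq_bigr => i _; rewrite fct_sumE.
apply: differentiable_sum => i; apply: differentiable_sum => j.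
exact: differentiableZl.
Qed.

Lemma derive_coord V m n (F : V -> 'M[R]_(m, n)) x h i j : derivable F x h ->
  'D_h (fun y => F y i j) x = ('D_h F x) i j.
Proof. by move=> dF; rewrite derive_mx // mxE. Qed.

Lemma is_derive_coord V m n (F : V -> 'M[R]_(m, n)) x h
    (dF : 'M[R]_(m, n)) i j :
  is_derive x h F dF -> is_derive x h (fun y => F y i j) (dF i j).
Proof.
case=> dF' <-; rewrite -derive_coord //; apply: DeriveDef => //.
exact: (derivable_mxP F x h).1.
Qed.

Lemma is_derive_mx V m n (F : V -> 'M[R]_(m, n)) x h
    (dF : 'M[R]_(m, n)) :
  (forall i j, is_derive x h (fun y => F y i j) (dF i j)) ->
  is_derive x h F dF.
Proof.
move=> H; have D : derivable F x h by apply/derivable_mxP => i j; case: (H i j).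
apply: DeriveDef => //; apply/matrixP => i j; rewrite derive_mx // mxE.
by case: (H i j).
Qed.

Lemma is_derive_mulmx V m n p (A : V -> 'M[R]_(m, n)) (B : V -> 'M[R]_(n, p))
    x h (dA : 'M[R]_(m, n)) (dB : 'M[R]_(n, p)) :
  is_derive x h A dA -> is_derive x h B dB ->
  is_derive x h (fun y => A y *m B y) (dA *m B x + A x *m dB).
Proof.
move=> HA HB; apply: is_derive_mx => i j.
have -> : (fun y => (A y *m B y) i j) =
   \sum_(k < n) ((fun y => A y i k) * (fun y => B y k j)).
  by apply/funext => y; rewrite mxE fct_sumE.
apply: (is_derive_eq (f' := \sum_(k < n)
    (A x i k *: dB k j + B x k j *: dA i k))).
  by apply: is_derive_sum => k; apply: is_deriveM; exact: is_derive_coord.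
rewrite !mxE -big_split; apply: eq_bigr => k _ /=.
by rewrite addrC; congr (_ + _); exact: mulrC.
Qed.

Lemma differentiable_mulmx V m n p (A : V -> 'M[R]_(m, n))
    (B : V -> 'M[R]_(n, p)) x :
  differentiable A x -> differentiable B x ->
  differentiable (fun y => A y *m B y) x.
Proof.
move=> /differentiable_mxP dA /differentiable_mxP dB; apply/differentiable_mxP.
move=> i j; rewrite (_ : (fun _ => _) =
    \sum_k (fun y => A y i k) * (fun y => B y k j)).
  by apply: differentiable_sum => k; exact: differentiableM.
by apply/funext => y; rewrite mxE fct_sumE.
Qed.

Lemma is_derive_line V W (f : V -> W) y h (u : R) :
  differentiable f (u *: h + y) ->
  is_derive u 1 (fun t => f (t *: h + y)) ('D_h f (u *: h + y)).
Proof.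
move=> df; have dl : is_diff u (fun t : R => t *: h + y) (fun t => t *: h).
  have -> : (fun t : R => t *: h + y) = ( *:%R ^~ h) + cst y by [].
  by apply: is_diff_eq; rewrite addr0.
have dl' : differentiable (fun t : R => t *: h + y) u by exact: ex_diff.
have D : differentiable (f \o (fun t : R => t *: h + y)) u.
  exact: differentiable_comp.
apply: DeriveDef; first exact: diff_derivable.
have := derive_chain (1 : R) dl' df; rewrite /comp => ->.
by rewrite (deriveE _ dl') diff_val scale1r.
Qed.

(** The mean value theorem along [h] turns the second difference into an
    increment of the derivative along [h], whose differentiability at [x]
    gives the leading term. *)
Lemma second_difference V (f : V -> R) x h k (e : R) :
  (\forall y \near x, differentiable f y) -> differentiable ('D_h f) x ->
  0 < e -> \forall s \near 0^'+,
    `|(f (s *: h + s *: k + x) - f (s *: h + x)) - (f (s *: k + x) - f x)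
      - 'D_k ('D_h f) x * s ^+ 2| <= e * s ^+ 2.
Proof.
move=> df dg e0; set g := 'D_h f.
(* Both points [u *: h + s *: k] and [u *: h], with [0 <= u <= s], are within
   [s * M] of the origin, and their norms add up to at most [s * M]. *)
pose M := `|h| *+ 2 + `|k| + 1.
have M0 : 0 < M by rewrite ltr_wpDl // addr_ge0 // mulrn_wge0.
have := diff_locally dg => /eqaddoP /(_ (e / M) (divr_gt0 e0 M0)) H.
have : \forall y \near (0 : V), differentiable f (y + x).
  by have := df; rewrite (near_shift 0) /= subr0.
move=> /(filterI H) /nbhs_ballP[d /= d0 dP].
near=> s.
have s0 : 0 < s by near: s; exact: nbhs_right_gt.
have sd : s * M < d.
  rewrite -ltr_pdivlMr //; near: s; apply: nbhs_right_lt; exact: divr_gt0.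
have line0 (u : R) (y : V) : `|y| < d ->
    differentiable f (y + x) /\
    `|g (y + x) - (g x + 'd g x y)| <= e / M * `|y|.
  move=> yd; have /dP[/= ? ?] : ball (0 : V) d y.
    by rewrite -ball_normE /= sub0r normrN.
  by split.
have small1 u : 0 <= u <= s -> `|u *: h| < d.
  move=> /andP[u0 us]; apply: le_lt_trans sd; rewrite normrZ ger0_norm //.
  apply: ler_pM => //; rewrite /M; apply: (@le_trans _ _ (`|h| *+ 2)).
    by rewrite mulr2n lerDl.
  by rewrite -addrA lerDl addr_ge0.
have small2 u : 0 <= u <= s -> `|u *: h + s *: k| < d.
  move=> /andP[u0 us]; apply: le_lt_trans sd; apply: (le_trans (ler_normD _ _)).
  rewrite !normrZ ger0_norm // (gtr0_norm s0).
  apply: (@le_trans _ _ (s * `|h| + s * `|k|)); first by rewrite lerD2r ler_wpM2r.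
  rewrite -mulrDr ler_pM2l // /M mulr2n -!addrA lerD2l.
  by rewrite addrCA lerDl addr_ge0.
pose phi u := f (u *: h + (s *: k + x)) - f (u *: h + x).
have dphi u : 0 <= u <= s -> is_derive u 1 phi
    (g (u *: h + (s *: k + x)) - g (u *: h + x)).
  move=> us; apply: is_deriveB; apply: is_derive_line.
    by rewrite addrA; have [] := line0 u _ (small2 u us).
  by have [] := line0 u _ (small1 u us).
have [||c] := @MVT R phi (fun u => g (u *: h + (s *: k + x)) - g (u *: h + x))
     0 s s0.
- by move=> u; rewrite in_itv /= => /andP[/ltW u0 /ltW us]; apply: dphi; rewrite u0.
- apply: derivable_within_continuous => u; rewrite in_itv /= => us.
  by case: (dphi u us).
rewrite in_itv /= => /andP[/ltW c0 /ltW cs].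
have cI : 0 <= c <= s by rewrite c0.
rewrite /phi scale0r !add0r subr0 !addrA => ->.
have [_ A1] := line0 c _ (small2 c cI).
have [_ A2] := line0 c _ (small1 c cI).
rewrite expr2 mulrA -mulrBl normrM (gtr0_norm s0) mulrA ler_pM2r //.
have -> : 'D_k g x * s = 'd g x (s *: k) by rewrite deriveE // linearZ /= mulrC.
set X1 := g _; set X2 := g _ in A2 *.
have -> : X1 - X2 - 'd g x (s *: k) =
   (X1 - (g x + 'd g x (c *: h + s *: k))) - (X2 - (g x + 'd g x (c *: h))).
  rewrite linearD /=; set a1 := 'd g x _; set a2 := 'd g x _.
  by rewrite !opprD !addrA; lra.
apply: (le_trans (ler_normB _ _)); apply: (le_trans (lerD A1 A2)).
rewrite -mulrDr -mulrA ler_pM2l // mulrC ler_pdivrMr //.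
apply: (@le_trans _ _ ((s * `|h| + s * `|k|) + s * `|h|)).
  apply: lerD; last by rewrite normrZ ger0_norm // ler_wpM2r.
  apply: (le_trans (ler_normD _ _)); rewrite !normrZ ger0_norm // (gtr0_norm s0).
  by rewrite lerD2r ler_wpM2r.
rewrite -!mulrDr ler_pM2l // /M mulr2n addrAC -!addrA.
by rewrite lerD2l lerD2l lerDl.
Unshelve. all: by end_near. Qed.

(** Young's theorem: up to the order of its terms, the same second difference
    of [f] is equivalent to [s ^+ 2] times either of the iterated derivatives. *)
Lemma derive_comm V (f : V -> R) x h k :
  (\forall y \near x, differentiable f y) ->
  differentiable ('D_h f) x -> differentiable ('D_k f) x ->
  'D_k ('D_h f) x = 'D_h ('D_k f) x.
Proof.
move=> df dh dk; apply/eqP; rewrite -subr_eq0 -normr_le0.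
apply/ler_addgt0Pl => e e0; rewrite addr0.
have e20 : 0 < e / 2 by rewrite divr_gt0.
have H1 := second_difference k df dh e20.
have H2 := second_difference h df dk e20.
have [s [[A1 A2] s0]] := filter_ex (filterI (filterI H1 H2) (nbhs_right_gt (0 : R))).
have : (e / 2 * s ^+ 2) *+ 2 >= `|('D_k ('D_h f) x - 'D_h ('D_k f) x) * s ^+ 2|.
  rewrite mulr2n; apply: le_trans (lerD A2 A1); apply: le_trans (ler_normB _ _).
  rewrite [s *: k + s *: h]addrC.
  move: (f _) (f _) (f _) (f _) ('D_k _ x) ('D_h _ x) => f1 f2 f3 f4 d1 d2.
  by rewrite [X in _ <= `|X|](_ : _ = (d1 - d2) * s ^+ 2) //; ring.

rewrite normrM [X in _ * X <= _]ger0_norm ?sqr_ge0 // -mulrnAl -mulr_natr divfK //.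
by rewrite ler_pM2r // exprn_gt0.
Qed.

End Calculus.

(** * Closure properties of smooth functions *)

Section Smooth.
Context {R : realType}.
Implicit Types V W : normedModType R.

Lemma open_near V (U : set V) x : open U -> U x -> \forall y \near x, U y.
Proof. by move=> oU Ux; exact: open_nbhs_nbhs. Qed.

Lemma Ck_ext V W k (U : set V) (f g : V -> W) : open U ->
  (forall x, U x -> f x = g x) -> Ck k U f -> Ck k U g.
Proof.
move=> oU; elim: k f g => [|k IH] f g fg /=.
  move=> cf x Ux; have := cf x Ux; rewrite /prop_for /continuous_at -fg //.
  apply: cvg_trans; apply: near_eq_cvg; apply: filterS (open_near oU Ux) => y.
  exact: fg.
case=> df Df; have fgn x : U x -> \forall y \near x, f y = g y.
  by move=> Ux; apply: filterS (open_near oU Ux) => y; exact: fg.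
split=> [x Ux|h].
  exact: near_eq_differentiable (fgn x Ux) (df x Ux).
by apply: IH (Df h) => x Ux; apply: near_eq_derive; exact: fgn.
Qed.

Lemma CkW V W k (U : set V) (f : V -> W) : Ck k.+1 U f -> Ck k U f.
Proof.
elim: k f => [|k IH] f [df Df].
  by move=> x Ux; apply: differentiable_continuous; exact: df.
by split=> // h; apply: IH; exact: Df.
Qed.

Lemma Ck_cst V W k (U : set V) (w : W) : Ck k U (fun=> w).
Proof.
elim: k w => [|k IH] w /=; first by move=> x _; exact: cst_continuous.
split=> [x _|h]; first exact: differentiable_cst.
have -> : 'D_h (fun=> w) = (fun=> 0) :> (V -> W).
  by apply/funext => x; exact: derive_cst.
exact: IH.
Qed.

Lemma CkD V W k (U : set V) (f g : V -> W) : open U ->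
  Ck k U f -> Ck k U g -> Ck k U (fun x => f x + g x).
Proof.
move=> oU; elim: k f g => [|k IH] f g /=.
  move=> cf cg x Ux; exact: (continuousD (cf x Ux) (cg x Ux)).
case=> df Df [dg Dg]; split=> [x Ux|h].
  exact: (differentiableD (df x Ux) (dg x Ux)).
apply: Ck_ext oU _ (IH _ _ (Df h) (Dg h)) => x Ux.
by rewrite (deriveD (diff_derivable (df x Ux)) (diff_derivable (dg x Ux))).
Qed.

Lemma Ck_sum V W k (U : set V) n (f : 'I_n -> V -> W) : open U ->
  (forall i, Ck k U (f i)) -> Ck k U (fun x => \sum_i f i x).
Proof.
move=> oU Cf.
suff : Ck k U (\sum_i f i).
  by congr (Ck k U _); apply/funext => x; rewrite fct_sumE.
elim/big_ind : _ => [|F G CF CG|i _]; [exact: Ck_cst|exact: CkD|exact: Cf].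
Qed.

Lemma CkM V k (U : set V) (f g : V -> R) : open U ->
  Ck k U f -> Ck k U g -> Ck k U (fun x => f x * g x).
Proof.
move=> oU; elim: k f g => [|k IH] f g.
  move=> cf cg x Ux; exact: (continuousM (cf x Ux) (cg x Ux)).
move=> Cf Cg; have [df Df] := Cf; have [dg Dg] := Cg; split=> [x Ux|h].
  exact: (differentiableM (df x Ux) (dg x Ux)).
apply: Ck_ext oU _ (CkD oU (IH _ _ (CkW Cf) (Dg h)) (IH _ _ (CkW Cg) (Df h))).
move=> x Ux.
by rewrite (deriveM (diff_derivable (df x Ux)) (diff_derivable (dg x Ux))).
Qed.

Lemma CkZl V W k (U : set V) (f : V -> R) (w : W) : open U ->
  Ck k U f -> Ck k U (fun x => f x *: w).
Proof.
move=> oU; elim: k f => [|k IH] f /=.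
  by move=> cf x Ux; apply: cvgZr_tmp; exact: cf.
case=> df Df; split=> [x Ux|h]; first exact: differentiableZl (df x Ux).
apply: Ck_ext oU _ (IH _ (Df h)) => x Ux.
have dZ : differentiable (fun y => f y *: w) x := differentiableZl w (df x Ux).
by rewrite (deriveE _ dZ) (diffZl w (df x Ux)) (deriveE _ (df x Ux)).
Qed.

Lemma Ck_mx V m n k (U : set V) (F : V -> 'M[R]_(m, n)) : open U ->
  (forall i j, Ck k U (fun x => F x i j)) -> Ck k U F.
Proof.
move=> oU CF.
have -> : F = fun x => \sum_(i < m) \sum_(j < n) (F x i j *: delta_mx i j).
  by apply/funext => x; exact: matrix_sum_delta.
apply: Ck_sum => // i; apply: Ck_sum => // j; exact: CkZl.
Qed.

Lemma Ck_coord V m n k (U : set V) (F : V -> 'M[R]_(m, n)) i j : open U ->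
  Ck k U F -> Ck k U (fun x => F x i j).
Proof.
move=> oU; elim: k F => [|k IH] F /=.
  move=> cF x Ux.
  exact: (@continuous_comp _ _ _ F (fun M : 'M[R]_(m, n) => M i j) x (cF x Ux)
    (@coord_continuous _ _ _ i j (F x))).
case=> dF DF; split=> [x Ux|h].
  exact: (differentiable_mxP F x).1 (dF x Ux) i j.
apply: Ck_ext oU _ (IH _ (DF h)) => x Ux.
by rewrite derive_coord //; exact: diff_derivable (dF x Ux).
Qed.

Lemma derive_linE V W (g : V -> W) y (c : R) h : differentiable g y ->
  'D_(c *: h) g y = c *: 'D_h g y.
Proof. by move=> dg; rewrite !(deriveE _ dg) linearZ. Qed.

Lemma derive1_dirE (g : R -> R) (y c : R) : differentiable g y ->
  'D_c g y = c * derive1 g y.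
Proof.
move=> dg; rewrite derive1E -[c in LHS]mulr1.
exact: (@derive_linE R R g y c 1 dg).
Qed.

Lemma Ck_comp V k (U : set V) (J : set R) (g : R -> R) (f : V -> R) : open U ->
  (forall x, U x -> J (f x)) -> Ck k J g -> Ck k U f -> Ck k U (g \o f).
Proof.
move=> oU UJ; elim: k g f UJ => [|k IH] g f UJ.
  move=> cg cf x Ux; apply: continuous_comp; first exact: cf.
  by apply: cg; exact: UJ.
move=> [dg Dg] Cf; have [df Df] := Cf; split=> [x Ux|h].
  exact: differentiable_comp (df x Ux) (dg _ (UJ x Ux)).
apply: Ck_ext oU _ (CkM oU (Df h) (IH _ _ UJ (Dg 1) (CkW Cf))) => x Ux.
rewrite (derive_chain _ (df x Ux) (dg _ (UJ x Ux))).
by rewrite (derive1_dirE _ (dg _ (UJ x Ux))) derive1E.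
Qed.

(** A solution of [f' = F (f)] gains one derivative at a time by the chain
    rule. Inverses, square roots and inverse functions all solve such an
    equation. *)
Lemma smooth_autonomous (J K : set R) (f F : R -> R) : open J ->
  (forall x, J x -> K (f x) /\ is_derive x 1 f (F (f x))) ->
  smooth K F -> smooth J f.
Proof.
move=> oJ Hf sF k.
have df x : J x -> differentiable f x.
  by move=> /Hf[_ [d _]]; exact/derivable1_diffP.
elim: k => [|k IH].
  by move=> x Jx; apply: differentiable_continuous; exact: df.
split=> // h.
have JK x : J x -> K (f x) by move=> /Hf[].
have := CkM oJ (@Ck_cst R R k J h) (Ck_comp oJ JK (sF k) IH).
apply: (Ck_ext oJ) => x Jx; rewrite (derive1_dirE _ (df x Jx)) derive1E.
by have [_ [_ ->]] := Hf x Jx.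
Qed.

Lemma smooth_id (J : set R) : smooth J (@id R).
Proof.
case=> [|k]; first by move=> x _; exact: cvg_id.
split=> [x _|h]; first exact: ex_diff.
have -> : 'D_h id = (fun=> h) :> (R -> R) by apply/funext => x; exact: derive_id.
exact: Ck_cst.
Qed.

Lemma open_neq0 : open [set x : R | x != 0].
Proof.
have -> : [set x : R | x != 0] = ~` [set 0].
  by apply/seteqP; split=> x /eqP.
exact/closed_openC/accessible_closed_set1/hausdorff_accessible/Rhausdorff.
Qed.

Lemma open_gt0 : open [set x : R | 0 < x].
Proof. exact: open_gt. Qed.

Lemma smooth_inv : smooth [set x : R | x != 0] GRing.inv.
Proof.
apply: (@smooth_autonomous _ setT _ (fun y => - 1 * (y * y)) open_neq0).
  move=> x x0; split=> //.
  have := @is_deriveV R id x 1 1 x0 (is_derive_id x 1).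
  congr (is_derive _ _ _ _); rewrite /= [LHS]mulr1 mulN1r.
  by rewrite -exprVn expr2.
move=> k; have oT : open (@setT R) by exact: openT.
apply: CkM => //; first exact: Ck_cst.
by apply: CkM => //; exact: smooth_id.
Qed.

Lemma smooth_sqrt : smooth [set x : R | 0 < x] Num.sqrt.
Proof.
have half0 : (2^-1 : R) != 0 by rewrite invr_eq0.
apply: (@smooth_autonomous _ [set x : R | x != 0] _ (fun y => 2^-1 * y^-1) open_gt0).
  move=> x x0; split; first by rewrite /= gt_eqF // sqrtr_gt0.
  by have := is_derive1_sqrt x0; rewrite invfM.
move=> k; apply: CkM; [exact: open_neq0|exact: Ck_cst|exact: smooth_inv].
Qed.

Lemma smooth_diff (V W : normedModType R) (S : set V) (f : V -> W) x :
  smooth S f -> S x -> differentiable f x.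
Proof. by move=> sf Sx; case: (sf 1%N) => + _; exact. Qed.

Lemma Ck_sub (V W : normedModType R) k (U U' : set V) (f : V -> W) :
  U' `<=` U -> Ck k U f -> Ck k U' f.
Proof.
move=> UU'; elim: k f => [|k IH] f /=; first by move=> H x /UU'; exact: H.
by case=> df Df; split=> [x /UU'|h]; [exact: df|exact: IH].
Qed.

Lemma smooth_entry n (U : set 'rV[R]_n) i : open U -> smooth U (fun q => q 0 i).
Proof.
move=> oU k; apply: Ck_coord => //; case: k => [|k].
  by move=> x _; exact: cvg_id.
split=> [x _|h]; first exact: ex_diff.
have -> : 'D_h id = (fun=> h) :> ('rV[R]_n -> 'rV[R]_n).
  by apply/funext => x; exact: derive_id.
exact: Ck_cst.
Qed.

End Smooth.

(** * Forms and Lie derivatives in Euclidean space *)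

Section DotProduct.
Context {R : realType} {n : nat}.
Implicit Types (u v w : 'rV[R]_n) (c : R) (M : 'M[R]_n).

Lemma dotE u v : dot u v = (u *m v^T) 0 0.
Proof. by rewrite !mxE; apply: eq_bigr => i _; rewrite mxE. Qed.

Lemma dotC u v : dot u v = dot v u.
Proof. by apply: eq_bigr => i _; rewrite mulrC. Qed.

Lemma dotDl u v w : dot (u + v) w = dot u w + dot v w.
Proof. by rewrite !dotE mulmxDl mxE. Qed.

Lemma dotDr u v w : dot u (v + w) = dot u v + dot u w.
Proof. by rewrite ![dot u _]dotC dotDl. Qed.

Lemma dotZl c u v : dot (c *: u) v = c * dot u v.
Proof. by rewrite !dotE -scalemxAl mxE. Qed.

Lemma dotZr c u v : dot u (c *: v) = c * dot u v.
Proof. by rewrite !(dotC u) dotZl. Qed.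

Lemma dotNl u v : dot (- u) v = - dot u v.
Proof. by rewrite -scaleN1r dotZl mulN1r. Qed.

Lemma dotNr u v : dot u (- v) = - dot u v.
Proof. by rewrite !(dotC u) dotNl. Qed.

Lemma dotBl u v w : dot (u - v) w = dot u w - dot v w.
Proof. by rewrite dotDl dotNl. Qed.

Lemma dot0l u : dot 0 u = 0.
Proof. by rewrite -(scale0r u) dotZl mul0r. Qed.

Lemma dot0r u : dot u 0 = 0.
Proof. by rewrite dotC dot0l. Qed.

Lemma dot_mulmx u M v : dot (u *m M) v = dot u (v *m M^T).
Proof. by rewrite !dotE trmx_mul trmxK mulmxA. Qed.

Lemma dot_delta u i : dot u (delta_mx 0 i) = u 0 i.
Proof.
rewrite /dot (bigD1 i) //= !mxE !eqxx mulr1 big1 ?addr0 // => j ji.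
by rewrite mxE (negbTE ji) andbF mulr0.
Qed.

Lemma dotvv_ge0 u : 0 <= dot u u.
Proof. by apply: sumr_ge0 => i _; rewrite -expr2 sqr_ge0. Qed.

Lemma dot_antisym M u v : M^T = - M -> dot (u *m M) v = - dot (v *m M) u.
Proof. by move=> MT; rewrite dot_mulmx MT mulmxN dotNr dotC. Qed.

Lemma dot_antisym0 M u : M^T = - M -> dot (u *m M) u = 0.
Proof. by move=> MT; have := dot_antisym u u MT; lra. Qed.

Lemma dot_skew M u v :
  dot (u *m (M - M^T)) v = dot (u *m M) v - dot (v *m M) u.
Proof. by rewrite mulmxBr dotBl (dot_mulmx _ M^T) trmxK (dotC u). Qed.

Lemma is_derive_dot (V : normedModType R) (X Y : V -> 'rV[R]_n) x h
    (dX dY : 'rV[R]_n) : is_derive x h X dX -> is_derive x h Y dY ->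
  is_derive x h (fun y => dot (X y) (Y y)) (dot dX (Y x) + dot (X x) dY).
Proof.
move=> HX HY.
have HYT : is_derive x h (fun y => (Y y)^T) dY^T.
  apply: is_derive_mx => i j; rewrite mxE.
  have -> : (fun y => (Y y)^T i j) = (fun y => Y y j i).
    by apply/funext => y; rewrite mxE.
  exact: is_derive_coord.
have := is_derive_coord 0 0 (is_derive_mulmx HX HYT).
rewrite mxE -!dotE; congr (is_derive _ _ _ _).
by apply/funext => y; rewrite dotE.
Qed.

Lemma differentiable_dot (V : normedModType R) (A B : V -> 'rV[R]_n) x :
  differentiable A x -> differentiable B x ->
  differentiable (fun y => dot (A y) (B y)) x.
Proof.
move=> /differentiable_mxP dA /differentiable_mxP dB.
rewrite (_ : (fun _ => _) = \sum_k (fun y => A y 0 k) * (fun y => B y 0 k)).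
  by apply: differentiable_sum => k; exact: differentiableM.
by apply/funext => y; rewrite fct_sumE.
Qed.

Lemma is_derive_dot_mulmx (V : normedModType R) (A B : V -> 'rV[R]_n) 
    (M : V -> 'M[R]_n) x h
    (dA dB : 'rV[R]_n) (dM : 'M[R]_n) :
  is_derive x h A dA -> is_derive x h M dM -> is_derive x h B dB ->
  is_derive x h (fun y => dot (A y *m M y) (B y))
    (dot (dA *m M x) (B x) + dot (A x *m dM) (B x) + dot (A x *m M x) dB).
Proof.
move=> HA HM HB; have := is_derive_dot (is_derive_mulmx HA HM) HB.
by rewrite dotDl.
Qed.

End DotProduct.

Section EuclideanForms.
Context {R : realType} {n : nat}.
Implicit Types (X w v : 'rV[R]_n -> 'rV[R]_n) (f : 'rV[R]_n -> R).
Implicit Types (x y u : 'rV[R]_n).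

Definition jac w x : 'M[R]_n := \matrix_(i, j) partial i (fun y => w y 0 j) x.

Lemma d1E w x : d1 w x = jac w x - (jac w x)^T.
Proof. by apply/matrixP => i j; rewrite !mxE. Qed.

Lemma d1_antisym w x : (d1 w x)^T = - d1 w x.
Proof. by rewrite d1E linearB /= trmxK opprB. Qed.

Lemma derive_jac w x u : differentiable w x -> 'D_u w x = u *m jac w x.
Proof.
move=> dw; rewrite deriveEjacobian //; congr (_ *m _).
apply/matrixP => i j; rewrite !mxE /partial derive_coord.
  by rewrite deriveEjacobian // !mxE (bigD1 i) //= !mxE !eqxx mul1r big1
    ?addr0 // => k ki; rewrite mxE (negbTE ki) mul0r.
exact: diff_derivable.
Qed.

Lemma derive_d0 f x u : differentiable f x -> 'D_u f x = dot u (d0 f x).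
Proof.
move=> df; rewrite (deriveE _ df) {1}(row_sum_delta u) linear_sum.
by apply: eq_bigr => i _; rewrite linearZ mxE /partial (deriveE _ df).
Qed.

Lemma d0_dot X w x : differentiable X x -> differentiable w x ->
  d0 (fun y => dot (X y) (w y)) x
  = X x *m (jac w x)^T + w x *m (jac X x)^T.
Proof.
move=> dX dw; apply/rowP => i; rewrite mxE /partial.
have [_ ->] := is_derive_dot (derivableP (diff_derivable dX (v := delta_mx 0 i)))
  (derivableP (diff_derivable dw (v := delta_mx 0 i))).
rewrite !derive_jac // dot_mulmx [dot (X x) _]dotC dot_mulmx addrC -dotDr.
by rewrite dotC dot_delta.
Qed.

Lemma lie_formE X w x :
  lie_form X w x = X x *m jac w x + w x *m (jac X x)^T.
Proof.
apply/rowP => j; rewrite !mxE -big_split; apply: eq_bigr => i _ /=.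
by rewrite !mxE.
Qed.

(** Cartan's formula. With [d1_d0] it reduces iterated Lie derivatives to
    exterior derivatives. *)
Lemma cartan X w x : differentiable X x -> differentiable w x ->
  lie_form X w x = X x *m d1 w x + d0 (fun y => dot (X y) (w y)) x.
Proof.
move=> dX dw; rewrite lie_formE d0_dot // d1E mulmxBr.
by rewrite addrA subrK.
Qed.

Lemma jac_near w w' x : (\forall y \near x, w y = w' y) -> jac w x = jac w' x.
Proof.
move=> ww'; apply/matrixP => i j; rewrite !mxE; apply: near_eq_derive.
by apply: filterS ww' => y ->.
Qed.

Lemma d0_near f f' x : (\forall y \near x, f y = f' y) -> d0 f x = d0 f' x.
Proof.
by move=> ff'; apply/rowP => i; rewrite !mxE; exact: near_eq_derive.
Qed.

Lemma jacD w w' x : differentiable w x -> differentiable w' x ->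
  jac (fun y => w y + w' y) x = jac w x + jac w' x.
Proof.
move=> /differentiable_mxP dw /differentiable_mxP dw'; apply/matrixP => i j.
rewrite !mxE /partial.
have -> : (fun y => (w y + w' y) 0 j) = (fun y => w y 0 j) + (fun y => w' y 0 j).
  by apply/funext => y; rewrite mxE.
by rewrite deriveD //; exact: diff_derivable.
Qed.

Lemma d1_d0 f x : (\forall y \near x, differentiable f y) ->
  differentiable (d0 f) x -> d1 (d0 f) x = 0.
Proof.
move=> df /differentiable_mxP ddf; apply/matrixP => i j; rewrite !mxE.
have E k : (fun y => d0 f y 0 k) = 'D_(delta_mx 0 k) f.
  by apply/funext => y; rewrite mxE.
have D k : differentiable ('D_(delta_mx 0 k) f) x by rewrite -E; exact: ddf.
rewrite /partial !E (derive_comm df (D j) (D i)); exact: subrr.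
Qed.

Lemma flat_euclid w : flat euclid w = w.
Proof. by apply/funext => x; rewrite /flat /euclid mulmx1. Qed.

Lemma vol_euclid x : vol euclid x = 1.
Proof. by rewrite /vol /euclid det1 sqrtr1. Qed.

Lemma divergence_euclid w x : divergence euclid w x = \tr (jac w x).
Proof.
rewrite /divergence vol_euclid invr1 mul1r; apply: eq_bigr => i _.
rewrite mxE; congr (partial i _ x); apply/funext => y.
by rewrite vol_euclid mul1r.
Qed.

Lemma codiff2_euclid (B : 'rV[R]_n -> 'M[R]_n) x : differentiable B x ->
  codiff2 euclid B x
  = - \sum_i (delta_mx 0 i : 'rV[R]_n) *m 'D_(delta_mx 0 i) B x.
Proof.
move=> dB; rewrite /codiff2 flat_euclid; apply/rowP => k; rewrite !mxE.
rewrite vol_euclid invr1 mul1r summxE; congr (- _); apply: eq_bigr => i _.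
have -> : (fun y => vol euclid y *
    (invmx (euclid y) *m B y *m invmx (euclid y)) i k) = (fun y => B y i k).
  by apply/funext => y; rewrite vol_euclid /euclid invmx1 mulmx1 mul1mx mul1r.
rewrite /partial derive_coord; last exact: diff_derivable.
by rewrite -rowE mxE.
Qed.

(** The term [d d^*] drops out, since [d^*] of the form is minus the divergence
    of the field. *)
Lemma hodge_euclid v x : (\forall y \near x, divergence euclid v y = 0) ->
  differentiable (d1 v) x ->
  hodge_laplacian euclid v x
  = - \sum_i (delta_mx 0 i : 'rV[R]_n) *m 'D_(delta_mx 0 i) (d1 v) x.
Proof.
move=> dv ddv; rewrite /hodge_laplacian codiff2_euclid //.
have -> : d0 (codiff1 euclid v) x = 0; last by rewrite add0r.
rewrite (d0_near (f' := fun=> 0)).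
  by apply/rowP => i; rewrite !mxE /partial derive_cst.
apply: filterS dv => y dv0; rewrite /codiff1.
have -> : sharp euclid v = v; last by rewrite dv0 oppr0.
by apply/funext => z; rewrite /sharp /euclid invmx1 mulmx1.
Qed.

(** Invariance of the trace: the rows of [M] are an orthonormal frame, so that
    [M^T *m M = 1] as well. *)
Lemma trace_frame (M : 'M[R]_n) (P : {linear 'rV[R]_n -> 'M[R]_n}) :
  M *m M^T = 1%:M ->
  \sum_i (delta_mx 0 i : 'rV[R]_n) *m P (delta_mx 0 i)
  = \sum_k row k M *m P (row k M).
Proof.
move=> /mulmx1C MM.
transitivity (\sum_k \sum_i \sum_j
    (M k i * M k j) *: ((delta_mx 0 i : 'rV[R]_n) *m P (delta_mx 0 j))).
  rewrite exchange_big; apply: eq_bigr => i _ /=.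
  rewrite exchange_big (bigD1 i) //= -scaler_suml.
  have E j : \sum_k M k i * M k j = (i == j)%:R.
    transitivity ((M^T *m M) i j); last by rewrite MM mxE.
    by rewrite mxE; apply: eq_bigr => k _; rewrite mxE.
  rewrite E eqxx scale1r big1 ?addr0 // => j ji.
  by rewrite -scaler_suml E eq_sym (negbTE ji) scale0r.
apply: eq_bigr => k _; rewrite [in RHS](row_sum_delta (row k M)) linear_sum /=.
rewrite mulmx_suml; apply: eq_bigr => i _.
rewrite -scalemxAl mulmx_sumr scaler_sumr; apply: eq_bigr => j _.
by rewrite linearZ /= -scalemxAr scalerA !mxE.
Qed.

(** Naturality of the exterior derivative: the second derivatives of [F] enter
    symmetrically and cancel. *)
Lemma d1_pullback m (F : 'rV[R]_m -> 'rV[R]_n) w (y : 'rV[R]_m) i j :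
  (\forall z \near y, differentiable F z) ->
  (forall k, differentiable ('D_(delta_mx 0 k) F) y) ->
  differentiable w (F y) ->
  d1 (pullback F w) y i j
  = dot ('D_(delta_mx 0 i) F y *m d1 w (F y)) ('D_(delta_mx 0 j) F y).
Proof.
move=> dF ddF dw.
have dFy := nbhs_singleton dF.
have P k l : partial k (fun z => pullback F w z 0 l) y =
    dot ('D_(delta_mx 0 k) F y *m jac w (F y)) ('D_(delta_mx 0 l) F y)
    + dot (w (F y)) ('D_(delta_mx 0 k) ('D_(delta_mx 0 l) F) y).
  have -> : (fun z => pullback F w z 0 l)
      = (fun z => dot ((w \o F) z) ('D_(delta_mx 0 l) F z)).
    by apply/funext => z; rewrite mxE.
  have dwF : differentiable (w \o F) y := differentiable_comp dFy dw.
  rewrite /partial; set h := delta_mx 0 k.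
  have [_ ->] := is_derive_dot (derivableP (diff_derivable dwF (v := h)))
    (derivableP (diff_derivable (ddF l) (v := h))).
  by rewrite (derive_chain h dFy dw) derive_jac.
have S : 'D_(delta_mx 0 j) ('D_(delta_mx 0 i) F) y
    = 'D_(delta_mx 0 i) ('D_(delta_mx 0 j) F) y.
  apply/rowP => l; pose Fl z := F z 0 l.
  have E k : \forall z \near y,
      'D_(delta_mx 0 k) F z 0 l = 'D_(delta_mx 0 k) Fl z.
    apply: filterS dF => z dFz; rewrite -derive_coord //.
    exact: diff_derivable.
  have dE k : differentiable ('D_(delta_mx 0 k) Fl) y.
    apply: near_eq_differentiable (E k) _.
    exact: (differentiable_mxP _ _).1 (ddF k) 0 l.
  have Q h k : 'D_h ('D_(delta_mx 0 k) F) y 0 l = 'D_h ('D_(delta_mx 0 k) Fl) y.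
    rewrite -(near_eq_derive h (E k)) [RHS]derive_coord //.
    exact: diff_derivable.
  have dFl : \forall z \near y, differentiable Fl z.
    by apply: filterS dF => z /differentiable_mxP; exact.
  have C := derive_comm dFl (dE i) (dE j).
  exact: etrans (Q (delta_mx 0 j) i) (etrans C (esym (Q (delta_mx 0 i) j))).
have K (p q c d : R) : d = c -> p + c - (q + d) = p - q by move=> ->; ring.
rewrite d1E dot_skew mxE.
apply: etrans (congr2 (fun a b => a - b) (P i j) (P j i)) _.
exact: K (congr1 (dot _) S).
Qed.

End EuclideanForms.

(** * The Hodge Laplacian of a warped metric *)

Section SmallOrdinals.

Lemma sum_ord2 (V : nmodType) (F : 'I_2 -> V) : \sum_i F i = F 0 + F 1.
Proof.
rewrite !big_ord_recl big_ord0 addr0.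
by congr (F _ + F _); apply: val_inj.
Qed.

Lemma sum_ord3 (V : nmodType) (F : 'I_3 -> V) : \sum_i F i = F 0 + F 1 + F 2.
Proof.
rewrite !big_ord_recl big_ord0 addr0 addrA.
by congr (F _ + F _ + F _); apply: val_inj.
Qed.

Lemma forall_ord2 (P : 'I_2 -> Prop) : P 0 -> P 1 -> forall i, P i.
Proof.
move=> P0 P1 [[|[|//]] lti].
  by rewrite (_ : Ordinal lti = 0) //; apply: val_inj.
by rewrite (_ : Ordinal lti = 1) //; apply: val_inj.
Qed.

Lemma forall_ord3 (P : 'I_3 -> Prop) : P 0 -> P 1 -> P 2 -> forall i, P i.
Proof.
move=> P0 P1 P2 [[|[|[|//]]] lti].
- by rewrite (_ : Ordinal lti = 0) //; apply: val_inj.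
- by rewrite (_ : Ordinal lti = 1) //; apply: val_inj.
- by rewrite (_ : Ordinal lti = 2) //; apply: val_inj.
Qed.

End SmallOrdinals.

Section WarpedMetric.
Context {R : realType}.
Implicit Types (g : 'rV[R]_2 -> 'M[R]_2) (al : 'rV[R]_2 -> 'rV[R]_2).
Implicit Types (A : 'rV[R]_2 -> R) (y : 'rV[R]_2) (c : R).

Definition warped_coef c : 'rV[R]_2 := \row_i (if i == 0 then 1 else c ^+ 2).

(** The metric [dt^2 + c^2 dtheta^2] of a surface of revolution, whose
    parallel at [t] has radius [c]. *)
Definition warped c : 'M[R]_2 := diag_mx (warped_coef c).

Lemma vol_warped g y c : 0 < c -> g y = warped c -> vol g y = c.
Proof.
move=> c0 gy; rewrite /vol gy det_diag !big_ord_recl big_ord0 !mxE /=.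
by rewrite mul1r mulr1 sqrtr_sqr gtr0_norm.
Qed.

Lemma invmx_warped c : c != 0 -> invmx (warped c) = warped c^-1.
Proof.
move=> c0; have H : warped c *m warped c^-1 = 1%:M.
  rewrite /warped mulmx_diag -diag_const_mx; congr diag_mx.
  apply/rowP; apply: forall_ord2; rewrite !mxE /= ?mulr1 //.
  by rewrite exprVn mulfV // expf_neq0.
have [u _] := mulmx1_unit H.
by rewrite -[LHS]mulmx1 -H mulmxA mulVmx // mul1mx.
Qed.

(** A 2-form on a surface is a function times the area form; [beta] is this
    function for [d al], and [d^*] rotates its gradient by a right angle. *)
Lemma hodge_warped g al A y :
  (\forall z \near y, 0 < A z /\ g z = warped (A z)) ->
  (\forall z \near y, divergence g (sharp g al) z = 0) ->
  let beta z := d1 al z 0 1 / A z in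
  differentiable beta y ->
  hodge_laplacian g al y 0 0 = (A y)^-1 * partial 1 beta y /\
  hodge_laplacian g al y 0 1 = - (A y * partial 0 beta y).
Proof.
move=> gA div0 beta dbeta; have [Ay0 gy] := nbhs_singleton gA.
have AyN0 : A y != 0 by rewrite gt_eqF.
have d00 : d0 (codiff1 g al) y = 0.
  rewrite (d0_near (f' := fun=> 0)).
    by apply/rowP => i; rewrite !mxE /partial derive_cst.
  by apply: filterS div0 => z; rewrite /codiff1 => ->; rewrite oppr0.
have E (i k : 'I_2) : \forall z \near y, vol g z *
    (invmx (g z) *m d1 al z *m invmx (g z)) i k
    = (if i == k then 0 else if i == 0 then beta z else - beta z).
  apply: filterS gA => z [Az0 gz]; rewrite (vol_warped Az0 gz) gz.
  have AzN0 : A z != 0 by rewrite gt_eqF.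
  rewrite invmx_warped // mul_diag_mx mul_mx_diag /beta.
  have S : d1 al z 1 0 = - d1 al z 0 1 by rewrite !mxE opprB.
  have S0 (j : 'I_2) : d1 al z j j = 0 by rewrite mxE subrr.
  move: (d1 al z) S S0 => B S S0.
  move: i k; do 2!apply: forall_ord2; rewrite !mxE /= ?S0
    ?mul0r ?mulr0 ?mul0r ?mulr0 // ?S.
    by rewrite exprVn; field.
  by rewrite exprVn; field.
have D (i k : 'I_2) : partial i (fun z => vol g z *
    (invmx (g z) *m d1 al z *m invmx (g z)) i k) y
    = partial i (fun z => if i == k then 0 else if i == 0 then beta z
                          else - beta z) y.
  exact: near_eq_derive (E i k).
have N : partial 1 (fun z => - beta z) y = - partial 1 beta y.
  by rewrite /partial [LHS]deriveN //; exact: diff_derivable.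
rewrite /hodge_laplacian d00 add0r /codiff2 /flat gy mul_mx_diag !mxE.
rewrite (vol_warped Ay0 gy) !sum_ord2 !D /=.
rewrite [partial 0 (fun=> 0) y]derive_cst [partial 1 (fun=> 0) y]derive_cst.
rewrite N add0r addr0 mulr1; split; first by rewrite mulrN opprK.
by field.
Qed.

Lemma div_warped g al A y :
  (\forall z \near y, 0 < A z /\ g z = warped (A z)) ->
  divergence g (sharp g al) y
  = (A y)^-1 * (partial 0 (fun z => A z * al z 0 0) y
               + partial 1 (fun z => al z 0 1 / A z) y).
Proof.
move=> gA; have [Ay0 gy] := nbhs_singleton gA.
rewrite /divergence (vol_warped Ay0 gy) sum_ord2; congr (_ * (_ + _));
  apply: near_eq_derive; apply: filterS gA => z [Az0 gz];
  have AzN0 : A z != 0 by rewrite gt_eqF.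
  rewrite (vol_warped Az0 gz) /sharp gz invmx_warped // mul_mx_diag !mxE /=.
  by rewrite mulr1.
rewrite (vol_warped Az0 gz) /sharp gz invmx_warped // mul_mx_diag !mxE /=.
by rewrite exprVn; field.
Qed.

End WarpedMetric.

(** * The frame of the chart *)

Section Row3.
Context {R : realType}.

Lemma row3E (x y z : R) :
  (row3 x y z 0 0 = x) * (row3 x y z 0 1 = y) * (row3 x y z 0 2 = z).
Proof. by rewrite !mxE. Qed.

Lemma row3P (u v : 'rV[R]_3) :
  u 0 0 = v 0 0 -> u 0 1 = v 0 1 -> u 0 2 = v 0 2 -> u = v.
Proof. by move=> h0 h1 h2; apply/rowP; apply: forall_ord3. Qed.

Lemma dot3E (u v : 'rV[R]_3) :
  dot u v = u 0 0 * v 0 0 + u 0 1 * v 0 1 + u 0 2 * v 0 2.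
Proof. exact: sum_ord3. Qed.

Lemma differentiable_row3 (V : normedModType R) (F G H : V -> R) x :
  differentiable F x -> differentiable G x -> differentiable H x ->
  differentiable (fun z => row3 (F z) (G z) (H z)) x.
Proof.
move=> dF dG dH; apply/differentiable_mxP => i; rewrite ord1 {i}.
apply: forall_ord3.
- by rewrite (_ : (fun _ => _) = F) //; apply/funext => z; rewrite row3E.
- by rewrite (_ : (fun _ => _) = G) //; apply/funext => z; rewrite row3E.
- by rewrite (_ : (fun _ => _) = H) //; apply/funext => z; rewrite row3E.
Qed.

Lemma is_derive_row3 (V : normedModType R) (F G H : V -> R) x h dF dG dH :
  is_derive x h F dF -> is_derive x h G dG -> is_derive x h H dH ->
  is_derive x h (fun z => row3 (F z) (G z) (H z)) (row3 dF dG dH).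
Proof.
move=> HF HG HH; apply: is_derive_mx => i; rewrite ord1 {i}.
apply: forall_ord3; rewrite row3E.
- by rewrite (_ : (fun _ => _) = F) //; apply/funext => z; rewrite row3E.
- by rewrite (_ : (fun _ => _) = G) //; apply/funext => z; rewrite row3E.
- by rewrite (_ : (fun _ => _) = H) //; apply/funext => z; rewrite row3E.
Qed.

Lemma is_derive_comp1 (V : normedModType R) (g : R -> R) (f : V -> R) x h df :
  differentiable f x -> is_derive x h f df -> differentiable g (f x) ->
  is_derive x h (fun z => g (f z)) (df * derive1 g (f x)).
Proof.
move=> Df [_ <-] Dg; apply: DeriveDef.
  exact/diff_derivable/(differentiable_comp Df Dg).
by have := derive_chain h Df Dg; rewrite /comp => ->; exact: derive1_dirE.
Qed.

Lemma is_derive_entry n (y h : 'rV[R]_n) i :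
  is_derive y h (fun z : 'rV[R]_n => z 0 i) (h 0 i).
Proof. exact: is_derive_coord (is_derive_id y h). Qed.

Lemma is_derive_entry_comp n (g : R -> R) (y h : 'rV[R]_n) i :
  differentiable g (y 0 i) ->
  is_derive y h (fun z : 'rV[R]_n => g (z 0 i)) (h 0 i * derive1 g (y 0 i)).
Proof.
by apply: is_derive_comp1; [exact: differentiable_coord|exact: is_derive_entry].
Qed.

Lemma differentiable_entry_comp n (g : R -> R) (y : 'rV[R]_n) i :
  differentiable g (y 0 i) -> differentiable (fun z : 'rV[R]_n => g (z 0 i)) y.
Proof. exact/differentiable_comp/differentiable_coord. Qed.

Lemma is_derive_mul (V : normedModType R) (f g : V -> R) x h df dg :
  is_derive x h f df -> is_derive x h g dg ->
  is_derive x h (fun z => f z * g z) (df * g x + f x * dg).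
Proof.
move=> Hf Hg; have := is_deriveM Hf Hg; congr (is_derive _ _ _ _).
by rewrite addrC; congr (_ + _); exact: mulrC.
Qed.

Lemma differentiable_is_derive1 (g : R -> R) t : differentiable g t ->
  is_derive t 1 g (derive1 g t).
Proof. by move=> dg; rewrite derive1E; exact/derivableP/diff_derivable. Qed.

Lemma differentiable_cos (x : R) : differentiable cos x.
Proof. exact/derivable1_diffP/derivable_cos. Qed.

Lemma differentiable_sin (x : R) : differentiable sin x.
Proof. exact/derivable1_diffP/derivable_sin. Qed.

Lemma derive1_cos (x : R) : derive1 cos x = - sin x.
Proof. by rewrite derive1E; case: (is_derive_cos x). Qed.

Lemma derive1_sin (x : R) : derive1 sin x = cos x.
Proof. by rewrite derive1E; case: (is_derive_sin x). Qed.

Lemma near_linear_approx (f : R -> R) (x l e : R) : is_derive x 1 f l -> 0 < e ->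
  \forall t \near x, `|f t - f x - l * (t - x)| <= e * `|t - x|.
Proof.
move=> [df <-] e0; have Df : differentiable f x by exact/derivable1_diffP.
have := diff_locally Df => /eqaddoP /(_ e e0).
rewrite (near_shift 0 x) /=; apply: filterS => h.
rewrite !fctE /= subr0 addrK opprD addrA (_ : 'd f x h = 'D_1 f x * h) //.
by rewrite -(deriveE _ Df) (derive1_dirE _ Df) derive1E mulrC.
Qed.

Lemma is_derive_inv (V : normedModType R) (f : V -> R) x h df :
  f x != 0 -> is_derive x h f df ->
  is_derive x h (fun z => (f z)^-1) (- (f x) ^- 2 * df).
Proof.
move=> fx [Df <-]; apply: DeriveDef; first exact: derivableV.
by rewrite deriveV.
Qed.

Lemma derive_entry0 n (g : R -> R) (y h : 'rV[R]_n) i : h 0 i = 0 ->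
  'D_h (fun z : 'rV[R]_n => g (z 0 i)) y = 0.
Proof.
move=> h0; rewrite /derive.
rewrite (_ : (fun _ => _) = fun=> 0); first exact: lim_cst.
by apply/funext => k; rewrite /= !mxE h0 mulr0 add0r subrr scaler0.
Qed.

End Row3.

Section OrthonormalFrames.
Context {R : realType}.

Definition orthonormal3 (e1 e2 e3 : 'rV[R]_3) := [/\ dot e1 e1 = 1, dot e2 e2 = 1,
  dot e3 e3 = 1 & [/\ dot e1 e2 = 0, dot e1 e3 = 0 & dot e2 e3 = 0]].

Lemma orthonormal3_mx (e1 e2 e3 : 'rV[R]_3) : orthonormal3 e1 e2 e3 ->
  let M := \matrix_(i < 3) [:: e1; e2; e3]`_i in M *m M^T = 1%:M.
Proof.
move=> [h11 h22 h33 [h12 h13 h23]] M.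
apply/matrixP => i j; rewrite !mxE.
under eq_bigr do rewrite !mxE.
move: i j; apply: forall_ord3; apply: forall_ord3;
  rewrite /= -/(dot _ _) ?h11 ?h22 ?h33 ?h12 ?h13 ?h23 //; by rewrite dotC.
Qed.

Lemma frame_expand (e1 e2 e3 u : 'rV[R]_3) : orthonormal3 e1 e2 e3 ->
  u = dot u e1 *: e1 + dot u e2 *: e2 + dot u e3 *: e3.
Proof.
move=> /orthonormal3_mx; set M := \matrix_(i < 3) _ => /mulmx1C MM.
rewrite -{1}[u]mulmx1 -MM mulmxA [u *m M^T *m M]mulmx_sum_row sum_ord3.
have E i : (u *m M^T) 0 i = dot u (row i M).
  by rewrite mxE; apply: eq_bigr => j _; rewrite !mxE.
by rewrite !E !rowK.
Qed.

Lemma trace_frame3 (e1 e2 e3 : 'rV[R]_3) (P : {linear 'rV[R]_3 -> 'M[R]_3}) :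
  orthonormal3 e1 e2 e3 ->
  \sum_i (delta_mx 0 i : 'rV[R]_3) *m P (delta_mx 0 i)
  = e1 *m P e1 + e2 *m P e2 + e3 *m P e3.
Proof.
move=> /orthonormal3_mx H.
by rewrite (trace_frame P H) sum_ord3 !rowK.
Qed.

Lemma mxtrace_frame3 (e1 e2 e3 : 'rV[R]_3) (J : 'M[R]_3) : orthonormal3 e1 e2 e3 ->
  \tr J = dot (e1 *m J) e1 + dot (e2 *m J) e2 + dot (e3 *m J) e3.
Proof.
move=> /orthonormal3_mx; set M := \matrix_(i < 3) _ => MM.
transitivity (\tr (M *m J *m M^T)).
  by rewrite -mulmxA mxtrace_mulC -mulmxA (mulmx1C MM) mulmx1.
rewrite /mxtrace sum_ord3.
have E i : (M *m J *m M^T) i i = dot (row i M *m J) (row i M).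
  rewrite -row_mul mxE; apply: eq_bigr => j _; by rewrite !mxE.
by rewrite !E !rowK.
Qed.

End OrthonormalFrames.

Section Frame.
Context {R : realType}.
Variables (a b : R -> R).
Implicit Types (y : 'rV[R]_2) (c : 'rV[R]_3).

Definition meridian y : 'rV[R]_3 :=
  row3 (derive1 a (y 0 0) * cos (y 0 1)) (derive1 a (y 0 0) * sin (y 0 1))
       (derive1 b (y 0 0)).

Definition parallel y : 'rV[R]_3 := row3 (- sin (y 0 1)) (cos (y 0 1)) 0.

Definition normal y : 'rV[R]_3 :=
  row3 (derive1 b (y 0 0) * cos (y 0 1)) (derive1 b (y 0 0) * sin (y 0 1))
       (- derive1 a (y 0 0)).

Lemma chartE y : chart a b y
  = row3 (a (y 0 0) * cos (y 0 1)) (a (y 0 0) * sin (y 0 1)) (b (y 0 0)).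
Proof. by rewrite /chart /Phi !row3E !mul1r. Qed.

Section At.
Variable y : 'rV[R]_2.
Hypothesis unit : derive1 a (y 0 0) ^+ 2 + derive1 b (y 0 0) ^+ 2 = 1.

Let cs : cos (y 0 1) ^+ 2 + sin (y 0 1) ^+ 2 = 1.
Proof. exact: cos2Dsin2. Qed.

Lemma frame_dot : orthonormal3 (meridian y) (parallel y) (normal y).
Proof.
move: unit cs; rewrite /orthonormal3 /meridian /parallel /normal.
move: (derive1 a _) (derive1 b _) (cos _) (sin _) => a' b' s c u1 u2.
rewrite !dot3E !row3E; split; [|by rewrite -u2; ring| |split; [ring| |ring]].
  by transitivity (a' ^+ 2 * (s ^+ 2 + c ^+ 2) + b' ^+ 2);
    [ring|rewrite u2 mulr1].
  by transitivity (b' ^+ 2 * (s ^+ 2 + c ^+ 2) + a' ^+ 2);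
    [ring|rewrite u2 mulr1 addrC].
by transitivity (a' * b' * (s ^+ 2 + c ^+ 2 - 1)); [ring|rewrite u2 subrr mulr0].
Qed.

End At.

Lemma dot_chart_normal y :
  dot (chart a b y) (normal y)
  = a (y 0 0) * derive1 b (y 0 0) - b (y 0 0) * derive1 a (y 0 0).
Proof.
have := cos2Dsin2 (y 0 1); rewrite chartE /normal dot3E !row3E.
move: (derive1 a _) (derive1 b _) (cos _) (sin _) => a' b' s c u.
transitivity (a (y 0 0) * b' * (s ^+ 2 + c ^+ 2) - b (y 0 0) * a'); first ring.
by rewrite u mulr1.
Qed.

Section ChartDerivatives.
Variable I : set R.
Hypotheses (sa : smooth I a) (sb : smooth I b).

Lemma smooth_derive1 (f : R -> R) : smooth I f -> smooth I (derive1 f).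
Proof.
move=> sf k; have -> : derive1 f = 'D_1 f by apply/funext => t; exact: derive1E.
by case: (sf k.+1) => _; exact.
Qed.

Lemma differentiable_chart y : I (y 0 0) -> differentiable (chart a b) y.
Proof.
move=> Iy; rewrite (_ : chart a b = fun z => row3 (a (z 0 0) * cos (z 0 1))
   (a (z 0 0) * sin (z 0 1)) (b (z 0 0))); last by apply/funext => z; exact: chartE.
have Da := differentiable_entry_comp (smooth_diff sa Iy).
have Dc := differentiable_entry_comp (differentiable_cos (y 0 1)).
have Ds := differentiable_entry_comp (differentiable_sin (y 0 1)).
apply: differentiable_row3.
- exact: differentiableM.
- exact: differentiableM.
- exact: differentiable_entry_comp (smooth_diff sb Iy).
Qed.

Lemma differentiable_meridian y : I (y 0 0) -> differentiable meridian y.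
Proof.
move=> Iy.
have Da := differentiable_entry_comp (smooth_diff (smooth_derive1 sa) Iy).
have Dc := differentiable_entry_comp (differentiable_cos (y 0 1)).
have Ds := differentiable_entry_comp (differentiable_sin (y 0 1)).
apply: differentiable_row3.
- exact: differentiableM.
- exact: differentiableM.
- exact: differentiable_entry_comp (smooth_diff (smooth_derive1 sb) Iy).
Qed.

Lemma differentiable_parallel y : differentiable parallel y.
Proof.
have Dc := differentiable_entry_comp (differentiable_cos (y 0 1)).
have Ds := differentiable_entry_comp (differentiable_sin (y 0 1)).
apply: differentiable_row3 => //; exact: differentiableN.
Qed.

Lemma chart_dt y : I (y 0 0) -> 'D_(delta_mx 0 0) (chart a b) y = meridian y.
Proof.
move=> Iy; rewrite (_ : chart a b = fun z => row3 (a (z 0 0) * cos (z 0 1))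
   (a (z 0 0) * sin (z 0 1)) (b (z 0 0))); last by apply/funext => z; exact: chartE.
set h := delta_mx 0 0.
have Ha := is_derive_entry_comp h (smooth_diff sa Iy).
have Hc := is_derive_entry_comp h (differentiable_cos (y 0 1)).
have Hs := is_derive_entry_comp h (differentiable_sin (y 0 1)).
have Hb := is_derive_entry_comp h (smooth_diff sb Iy).
have [_ ->] := is_derive_row3 (is_derive_mul Ha Hc) (is_derive_mul Ha Hs) Hb.
by apply: row3P; rewrite !row3E !mxE /=; ring.
Qed.

Lemma chart_dtheta y : I (y 0 0) ->
  'D_(delta_mx 0 1) (chart a b) y = a (y 0 0) *: parallel y.
Proof.
move=> Iy; rewrite (_ : chart a b = fun z => row3 (a (z 0 0) * cos (z 0 1))
   (a (z 0 0) * sin (z 0 1)) (b (z 0 0))); last by apply/funext => z; exact: chartE.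
set h := delta_mx 0 1.
have Ha := is_derive_entry_comp h (smooth_diff sa Iy).
have Hc := is_derive_entry_comp h (differentiable_cos (y 0 1)).
have Hs := is_derive_entry_comp h (differentiable_sin (y 0 1)).
have Hb := is_derive_entry_comp h (smooth_diff sb Iy).
have [_ ->] := is_derive_row3 (is_derive_mul Ha Hc) (is_derive_mul Ha Hs) Hb.
by apply: row3P; rewrite [RHS]mxE !row3E !mxE /= ?derive1_cos ?derive1_sin; ring.
Qed.

Lemma meridian_dt y : I (y 0 0) -> 'D_(delta_mx 0 0) meridian y
  = row3 (derive1 (derive1 a) (y 0 0) * cos (y 0 1))
         (derive1 (derive1 a) (y 0 0) * sin (y 0 1))
         (derive1 (derive1 b) (y 0 0)).
Proof.
move=> Iy; set h := delta_mx 0 0.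
have Ha := is_derive_entry_comp h (smooth_diff (smooth_derive1 sa) Iy).
have Hc := is_derive_entry_comp h (differentiable_cos (y 0 1)).
have Hs := is_derive_entry_comp h (differentiable_sin (y 0 1)).
have Hb := is_derive_entry_comp h (smooth_diff (smooth_derive1 sb) Iy).
have [_ E] := is_derive_row3 (is_derive_mul Ha Hc) (is_derive_mul Ha Hs) Hb.
rewrite [LHS]E.
by apply: row3P; rewrite !row3E !mxE /=; ring.
Qed.

Lemma meridian_dtheta y : I (y 0 0) ->
  'D_(delta_mx 0 1) meridian y = derive1 a (y 0 0) *: parallel y.
Proof.
move=> Iy; set h := delta_mx 0 1.
have Ha := is_derive_entry_comp h (smooth_diff (smooth_derive1 sa) Iy).
have Hc := is_derive_entry_comp h (differentiable_cos (y 0 1)).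
have Hs := is_derive_entry_comp h (differentiable_sin (y 0 1)).
have Hb := is_derive_entry_comp h (smooth_diff (smooth_derive1 sb) Iy).
have [_ E] := is_derive_row3 (is_derive_mul Ha Hc) (is_derive_mul Ha Hs) Hb.
rewrite [LHS]E.
by apply: row3P; rewrite [RHS]mxE !row3E !mxE /= ?derive1_cos ?derive1_sin; ring.
Qed.

Lemma derive_parallel y h :
  'D_h parallel y = - h 0 1 *: row3 (cos (y 0 1)) (sin (y 0 1)) 0.
Proof.
have Hc := is_derive_entry_comp h (differentiable_cos (y 0 1)).
have Hs := is_derive_entry_comp h (differentiable_sin (y 0 1)).
have [_ E] := is_derive_row3 (is_deriveN Hs) Hc (is_derive_cst (0 : R) y h).
rewrite [LHS]E.
by apply: row3P; rewrite [RHS]mxE !row3E ?derive1_cos ?derive1_sin; ring.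
Qed.

End ChartDerivatives.

End Frame.

(** * Tangent vectors of the surface *)

Section Tangent.
Context {R : realType}.
Variables (C : set (R * R)) (I : set R) (a b : R -> R).
Hypotheses (Cpos : forall c, C c -> 0 < c.1) (lp : local_param C I a b).
Hypothesis us : unit_speed I a b.

Lemma param_mem t : I t -> C (a t, b t).
Proof.
move=> It; case: lp => -[oI _] _ _ _ /(_ I oI (@subset_refl _ I))[W [_ E]].
have : [set (a t, b t) | t in I] (a t, b t) by exists t.
by rewrite E => -[].
Qed.

Lemma param_gt0 t : I t -> 0 < a t.
Proof. by move=> /param_mem /Cpos. Qed.

Lemma profile_chart (y : 'rV[R]_2) : I (y 0 0) ->
  profile (chart a b y) = (a (y 0 0), b (y 0 0)).
Proof.
move=> Iy; rewrite /profile chartE !row3E; congr (_, _).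
have := cos2Dsin2 (y 0 1); move: (cos _) (sin _) => c s cs.
rewrite (_ : _ + _ = a (y 0 0) ^+ 2); first by rewrite sqrtr_sqr gtr0_norm // param_gt0.
by transitivity (a (y 0 0) ^+ 2 * (c ^+ 2 + s ^+ 2)); [ring|rewrite cs mulr1].
Qed.

Lemma surface_chart (y : 'rV[R]_2) : I (y 0 0) -> surface C (chart a b y).
Proof. by move=> Iy; rewrite /surface /= profile_chart //; exact: param_mem. Qed.

(** The set [C] is tangent to the parametrized arc. The last clause of
    [local_param] is essential: it keeps the points of [C] near [(a t1, b t1)]
    on a short piece of the arc, where the displacement along the normal is
    negligible with respect to the displacement along the tangent. *)
Lemma normal_coord_small t1 (e : R) : I t1 -> 0 < e ->
  exists O : set (R * R), [/\ open O, O (a t1, b t1) & forall c, O c -> C c ->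
   `|derive1 b t1 * (c.1 - a t1) - derive1 a t1 * (c.2 - b t1)|
   <= e * `|derive1 a t1 * (c.1 - a t1) + derive1 b t1 * (c.2 - b t1)| ].
Proof.
move=> It e0; case: lp => -[oI _] [sa sb] _ inj lh.
have Ha : is_derive t1 1 a (derive1 a t1).
  exact: differentiable_is_derive1 (smooth_diff sa It).
have Hb : is_derive t1 1 b (derive1 b t1).
  exact: differentiable_is_derive1 (smooth_diff sb It).
(* With [e1 <= 1/4] the tangential displacement is at least half of
   [|t - t1|], and [e / 4] is then small enough for the normal one. *)
pose e1 := Num.min (e / 4) 4^-1.
have e10 : 0 < e1 by rewrite lt_min divr_gt0 //= invr_gt0.
have Na := near_linear_approx Ha e10; have Nb := near_linear_approx Hb e10.
have NI := open_near oI It.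
have /nbhs_ballP[d /= d0 dP] : nbhs t1
    (fun t => (`|a t - a t1 - derive1 a t1 * (t - t1)| <= e1 * `|t - t1| /\
               `|b t - b t1 - derive1 b t1 * (t - t1)| <= e1 * `|t - t1|) /\ I t).
  exact: filterI (filterI Na Nb) NI.
have oJ : open (ball t1 d) by exact: ball_open.
have JI : ball t1 d `<=` I by move=> t /dP[].
have [W [oO OE]] := lh _ oJ JI.
have O1 : W (a t1, b t1).
  suff : (C `&` W) (a t1, b t1) by case.
  by rewrite -OE; exists t1 => //; exact: ballxx.
exists W; split=> // c Oc Cc.
have : (C `&` W) c by [].
rewrite -OE => -[t /dP[/= [At Bt] _] <-] /=.
have := us It; move: At Bt.
set a' := derive1 a t1; set b' := derive1 b t1.
set x := a t - a t1; set z := b t - b t1; set h := t - t1 => At Bt u.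
have a1 : `|a'| <= 1.
  by rewrite ler_norml; apply/andP; split; nra.
have b1 : `|b'| <= 1.
  by rewrite ler_norml; apply/andP; split; nra.
have F : `|b' * x - a' * z| <= 2 * e1 * `|h|.
  have -> : b' * x - a' * z = b' * (x - a' * h) - a' * (z - b' * h) by ring.
  apply: (le_trans (ler_normB _ _)); rewrite !normrM.
  have := ler_pM (normr_ge0 _) (normr_ge0 _) b1 At.
  by have := ler_pM (normr_ge0 _) (normr_ge0 _) a1 Bt; lra.
have G : `|(a' * x + b' * z) - h| <= 2 * e1 * `|h|.
  have -> : a' * x + b' * z - h = a' * (x - a' * h) + b' * (z - b' * h).
    by transitivity (a' * x + b' * z - (a' ^+ 2 + b' ^+ 2) * h);
      [rewrite u mul1r|ring].
  apply: (le_trans (ler_normD _ _)); rewrite !normrM.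
  have := ler_pM (normr_ge0 _) (normr_ge0 _) a1 At.
  by have := ler_pM (normr_ge0 _) (normr_ge0 _) b1 Bt; lra.
have e1e : e1 <= e / 4 by rewrite ge_min lexx.
have e14 : e1 <= 4^-1 by rewrite ge_min lexx orbT.
have h0 := normr_ge0 h.
have Gh : `|h| <= 2 * `|a' * x + b' * z|.
  have T : `|h| <= `|a' * x + b' * z| + `|(a' * x + b' * z) - h|.
    rewrite -{1}[h](subKr (a' * x + b' * z)).
    exact: ler_normB.
  have : e1 * `|h| <= 4^-1 * `|h| by apply: ler_wpM2r.
  by lra.
apply: (le_trans F).
have : e1 * `|h| <= e / 4 * `|h| by apply: ler_wpM2r.
have : e / 4 * `|h| <= e / 4 * (2 * `|a' * x + b' * z|).
  by apply: ler_wpM2l => //; rewrite divr_ge0 // ltW.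
by lra.
Qed.

Lemma is_derive_radius (c : R -> 'rV[R]_3) (t : R) (dc : 'rV[R]_3) (r th : R) : 0 < r ->
  is_derive t 1 c dc -> c t 0 0 = r * cos th -> c t 0 1 = r * sin th ->
  is_derive t 1 (fun s => Num.sqrt (c s 0 0 ^+ 2 + c s 0 1 ^+ 2))
    (dc 0 0 * cos th + dc 0 1 * sin th).
Proof.
move=> r0 Hc c0 c1.
have H0 := is_derive_coord 0 0 Hc; have H1 := is_derive_coord 0 1 Hc.
have Q := is_deriveD (is_derive_mul H0 H0) (is_derive_mul H1 H1).
pose q s := c s 0 0 * c s 0 0 + c s 0 1 * c s 0 1.
have qt : q t = r ^+ 2.
  rewrite /q c0 c1; have := cos2Dsin2 th; move: (cos _) (sin _) => x y xy.
  by transitivity (r ^+ 2 * (x ^+ 2 + y ^+ 2)); [ring|rewrite xy mulr1].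
have qt0 : 0 < q t by rewrite qt exprn_gt0.
have Hs := is_derive1_sqrt qt0.
have Dq : differentiable q t by apply/derivable1_diffP; case: Q.
have Ds : differentiable Num.sqrt (q t) by apply/derivable1_diffP; case: Hs.
have := is_derive_comp1 Dq Q Ds.
rewrite derive1E; have [_ ->] := Hs; rewrite qt sqrtr_sqr gtr0_norm // c0 c1.
have r0' : r != 0 by rewrite gt_eqF.
by congr (is_derive _ _ _ _); field.
Qed.

(** For a curve in [S], the normal displacement of its profile is negligible
    with respect to the tangential one, which is at most of first order; hence
    its derivative vanishes. *)
Lemma tangent_normal (y : 'rV[R]_2) (x : 'rV[R]_3) : 
  I (y 0 0) -> tangent (surface C) (chart a b y) x ->
  dot x (normal a b y) = 0.
Proof.
move=> Iy [e [c [e0 sc Sc c0 dc]]].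
set t1 := y 0 0 in Iy *; set th := y 0 1.
have ee0 : `]-e, e[%classic (0 : R) by rewrite /= in_itv /= oppr_lt0 e0.
have Dc : differentiable c (0 : R) by case: (sc 1%N) => + _; exact.
have Hc : is_derive (0 : R) 1 c x.
  by rewrite -dc derive1E; apply: derivableP; exact: diff_derivable.
have a0 := param_gt0 Iy.
have [c00 c01 c02] : [/\ c 0 0 0 = a t1 * cos th, c 0 0 1 = a t1 * sin th
    & c 0 0 2 = b t1] by rewrite c0 chartE !row3E.
have Hr := is_derive_radius a0 Hc c00 c01.
have Hz := is_derive_coord 0 2 Hc.
pose P s := profile (c s).
have P0 : P 0 = (a t1, b t1) by rewrite /P c0 profile_chart.
set a' := derive1 a t1; set b' := derive1 b t1.
pose hn s := b' * ((P s).1 - a t1) - a' * ((P s).2 - b t1).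
pose ht s := a' * ((P s).1 - a t1) + b' * ((P s).2 - b t1).
set r' := x 0 0 * cos th + x 0 1 * sin th in Hr.
have Ca : is_derive (0 : R) 1 (fun=> a t1) 0 by exact: is_derive_cst.
have Cb : is_derive (0 : R) 1 (fun=> b t1) 0 by exact: is_derive_cst.
have Hn : is_derive (0 : R) 1 hn (b' * r' - a' * x 0 2).
  have := is_deriveB (is_deriveZ b' (is_deriveB Hr Ca))
    (is_deriveZ a' (is_deriveB Hz Cb)).
  by rewrite !subr0.
have Ht : is_derive (0 : R) 1 ht (a' * r' + b' * x 0 2).
  have := is_deriveD (is_deriveZ a' (is_deriveB Hr Ca))
    (is_deriveZ b' (is_deriveB Hz Cb)).
  by rewrite !subr0.
have hn0 : hn 0 = 0 by rewrite /hn P0 !subrr !mulr0 subrr.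
have ht0 : ht 0 = 0 by rewrite /ht P0 !subrr !mulr0 addr0.
have -> : dot x (normal a b y) = b' * r' - a' * x 0 2.
  by rewrite /normal dot3E !row3E -/t1 -/th -/a' -/b' /r'; ring.
set n := b' * r' - _ in Hn *; set g := a' * r' + _ in Ht.
apply/eqP; rewrite -normr_le0; apply/ler_addgt0Pl => k k0; rewrite addr0.
(* The estimate reached at the end is [|n| <= e1 * (|g| + 1 + e1)]. *)
pose e1 := Num.min 1 (k / (`|g| + 2)).
have g2 : 0 < `|g| + 2 by rewrite ltr_wpDl.
have e10 : 0 < e1 by rewrite lt_min ltr01 divr_gt0.
have e11 : e1 <= 1 by rewrite ge_min lexx.
have e1k : e1 * (`|g| + 2) <= k by rewrite -ler_pdivlMr // ge_min lexx orbT.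
have [W [oO O1 Osmall]] := normal_coord_small Iy e10.
have cP : {for 0, continuous P}.
  have K1 := differentiable_continuous
    ((derivable1_diffP _ _).1 (@ex_derive _ _ _ _ _ _ _ Hr)).
  have K2 := differentiable_continuous
    ((derivable1_diffP _ _).1 (@ex_derive _ _ _ _ _ _ _ Hz)).
  exact: (cvg_pair K1 K2).
have NO : \forall s \near (0 : R), W (P s).
  by apply: cP; rewrite P0; apply: open_nbhs_nbhs; split.
have Ne : \forall s \near (0 : R), -e < s < e.
  have : open `]-e, e[%classic by exact: itv_open.
  by move=> /open_near /(_ ee0); apply: filterS => s; rewrite /= in_itv.
have Nn := near_linear_approx Hn e10; have Nt := near_linear_approx Ht e10.
have Nall : \forall s \near (0 : R)^'+, [/\ 0 < s, W (P s), -e < s < e,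
    `|hn s - hn 0 - n * (s - 0)| <= e1 * `|s - 0| &
    `|ht s - ht 0 - g * (s - 0)| <= e1 * `|s - 0|].
  near=> s; split; near: s.
  - exact: nbhs_right_gt.
  - exact: cvg_within NO.
  - exact: cvg_within Ne.
  - exact: cvg_within Nn.
  - exact: cvg_within Nt.
have [s [s0 Os es]] := filter_ex Nall.
rewrite hn0 ht0 !subr0 (gtr0_norm s0) => An At.
have := Osmall _ Os (Sc s es); rewrite -/(hn s) -/(ht s) => Small.
have n1 : `|n| * s <= `|hn s| + e1 * s.
  rewrite -{1}(gtr0_norm s0) -normrM.
  have -> : n * s = hn s - (hn s - n * s) by ring.
  by apply: (le_trans (ler_normB _ _)); rewrite lerD2l.
have t1' : `|ht s| <= `|g| * s + e1 * s.
  rewrite -{2}(gtr0_norm s0) -normrM.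
  have -> : ht s = g * s + (ht s - g * s) by ring.
  by apply: (le_trans (ler_normD _ _)); rewrite lerD2l.
rewrite -(ler_pM2r s0).
have : e1 * `|ht s| <= e1 * (`|g| * s + e1 * s) by rewrite ler_pM2l.
have : e1 * (`|g| + 2) * s <= k * s by rewrite ler_pM2r.
have : e1 * (e1 * s) <= e1 * s by rewrite ler_pM2l // ler_piMl // ltW.
by lra.
Unshelve. all: by end_near. Qed.

(** If the determinant vanished, the position vector and all tangent vectors
    would be orthogonal to the normal, but by transversality they span the
    space. *)
Lemma transversal_det t : transversal_lines (surface C) -> I t ->
  b t * derive1 a t - a t * derive1 b t != 0.
Proof.
move=> tr It; apply/eqP => D0.
pose y : 'rV[R]_2 := \row_(i < 2) (if i == 0 then t else 0).
have y0 : y 0 0 = t by rewrite mxE.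
have Iy : I (y 0 0) by rewrite y0.
have q0 : chart a b y != 0.
  apply/eqP => q0; have := profile_chart Iy.
  rewrite q0 /profile !mxE expr0n addr0 sqrtr0 => -[a0 _].
  by have := param_gt0 It; rewrite -a0 ltxx.
have qq : exists s : R, chart a b y = s *: chart a b y by exists 1; rewrite scale1r.
have [s [x [Tx E]]] := tr _ q0 _ (surface_chart Iy) qq (normal a b y).
have [_ _ nn _] := frame_dot (us Iy).
have : dot (normal a b y) (normal a b y) = 0.
  rewrite {1}E dotDl dotZl dot_chart_normal (tangent_normal Iy Tx) addr0 y0.
  by rewrite -opprB D0 oppr0 mulr0.
by rewrite nn => /eqP; rewrite oner_eq0.
Qed.

End Tangent.

(** * The coordinates as smooth functions *)

Lemma polar_angle (R : realType) (u v : R) : u ^+ 2 + v ^+ 2 = 1 ->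
  exists th, cos th = u /\ sin th = v.
Proof.
move=> uv; have u1 : -1 <= u <= 1 by apply/andP; split; nra.
have sv : Num.sqrt (1 - u ^+ 2) = `|v|.
  by rewrite -uv addrAC subrr add0r sqrtr_sqr.
have [v0|v0] := leP 0 v.
  by exists (acos u); rewrite acosK ?in_itv // sin_acos // sv ger0_norm.
exists (- acos u); rewrite cosN sinN acosK ?in_itv // sin_acos // sv ltr0_norm //.
by rewrite opprK.
Qed.

Section Coordinates.
Context {R : realType}.
Variables (I : set R) (a b : R -> R).
Hypotheses (oI : open I) (itvI : is_interval I).
Hypotheses (sa : smooth I a) (sb : smooth I b).
Hypothesis apos : forall t, I t -> 0 < a t.
Hypothesis det : forall t, I t -> b t * derive1 a t - a t * derive1 b t != 0.

Let aN0 t : I t -> a t != 0. Proof. by move=> /apos; exact: lt0r_neq0. Qed.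

(** By transversality [b / a] has a nonzero derivative, so that it is a
    coordinate on the arc; at a point of space it is read off as [z / r]. *)
Definition slope t : R := b t * (a t)^-1.

Lemma smooth_slope : smooth I slope.
Proof.
move=> k; apply: CkM => //.
exact: (Ck_comp oI aN0 (@smooth_inv R k)).
Qed.

Lemma slope_derive1 t : I t -> derive1 slope t
  = - (b t * derive1 a t - a t * derive1 b t) / a t ^+ 2.
Proof.
move=> It; have a0 := aN0 It.
have Ha : is_derive t 1 a (derive1 a t).
  exact: differentiable_is_derive1 (smooth_diff sa It).
have Hb : is_derive t 1 b (derive1 b t).
  exact: differentiable_is_derive1 (smooth_diff sb It).
have [_] := is_derive_mul Hb (is_deriveV a0 Ha).
rewrite -derive1E => ->; rewrite [_ *: _]mulrC.
by field.
Qed.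

Lemma slope_derive1_neq0 t : I t -> derive1 slope t != 0.
Proof.
move=> It; rewrite slope_derive1 // mulf_neq0 ?oppr_eq0 ?det //.
by rewrite invr_eq0 expf_neq0 // aN0.
Qed.

Lemma dslope t : I t -> differentiable slope t.
Proof. by move=> It; case: (smooth_slope 1) => + _; exact. Qed.

Lemma slope_inj s t : I s -> I t -> slope s = slope t -> s = t.
Proof.
wlog st : s t / s < t.
  by move=> W Is It E; have [/W|/W Wts|//] := ltgtP s t; [exact|exact/esym/Wts].
move=> Is It E; exfalso.
have Ix x : s <= x <= t -> I x by exact: itvI.
have [||c cst [_ c0]] := Rolle st _ _ E.
- move=> x; rewrite in_itv /= => /andP[/ltW sx /ltW xt].
  by apply: diff_derivable; apply: dslope; apply: Ix; rewrite sx.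
- apply: derivable_within_continuous => x; rewrite in_itv /= => sxt.
  by apply: diff_derivable; apply: dslope; exact: Ix.
have Ic : I c.
  by move: cst; rewrite in_itv /= => /andP[/ltW ? /ltW ?]; apply/Ix/andP.
by have := slope_derive1_neq0 Ic; rewrite derive1E c0 eqxx.
Qed.

Definition slope_inv s : R := get [set t | I t /\ slope t = s].

Lemma slopeK t : I t -> slope_inv (slope t) = t.
Proof.
move=> It; have [I' E] : I (slope_inv (slope t)) /\ slope (slope_inv (slope t)) = slope t.
  by apply: (@getPex _ [set u | I u /\ slope u = slope t]); exists t.
exact: slope_inj E.
Qed.

Let nearK t : I t -> {near t, cancel slope slope_inv}.
Proof. by move=> It; apply: filterS (open_near oI It) => x; exact: slopeK. Qed.

Let nearC t : I t -> {near t, continuous slope}.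
Proof.
move=> It; apply: filterS (open_near oI It) => x Ix.
by apply: differentiable_continuous; exact: dslope.
Qed.

Lemma open_slope : open (slope @` I).
Proof.
rewrite openE => _ [t It <-]; rewrite /interior.
have [C K] := near_can_continuousAcan_sym (nearK It) (nearC It).
have NI : \forall s \near slope t, I (slope_inv s).
  have := nbhs_singleton C; rewrite /continuous_at slopeK // => Ct.
  exact: Ct (open_near oI It).
by near=> s; exists (slope_inv s); near: s; [exact: NI|exact: K].
Unshelve. all: by end_near. Qed.

Lemma smooth_slope_inv : smooth (slope @` I) slope_inv.
Proof.
apply: (@smooth_autonomous _ _ I _ (fun t => (derive1 slope t)^-1) open_slope).
  move=> _ [t It <-]; rewrite slopeK //; split=> //.
  apply: (@is_derive_inverse _ slope slope_inv) => //;
    [exact: nearK|exact: nearC| |exact: slope_derive1_neq0].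
  by rewrite derive1E; apply: derivableP; apply: diff_derivable; exact: dslope.
move=> k; apply: (Ck_comp oI slope_derive1_neq0 (@smooth_inv R k)).
exact: smooth_derive1 smooth_slope k.
Qed.

Definition radius (q : 'rV[R]_3) : R := Num.sqrt (q 0 0 * q 0 0 + q 0 1 * q 0 1).

Definition axis_free : set 'rV[R]_3 :=
  [set q | 0 < q 0 0 * q 0 0 + q 0 1 * q 0 1].

(** The open cone over the piece of [S] above the arc, on which [(rho, t)] and
    the direction of the half plane through the axis are well defined. *)
Definition cone : set 'rV[R]_3 :=
  [set q | axis_free q /\ (slope @` I) (q 0 2 * (radius q)^-1)].

Lemma open_axis_free : open axis_free.
Proof.
have C : smooth setT (fun q : 'rV[R]_3 => q 0 0 * q 0 0 + q 0 1 * q 0 1).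
  move=> k; have oT : open (@setT 'rV[R]_3) by exact: openT.
  by apply: CkD => //; apply: CkM => //; exact: smooth_entry.
rewrite openE => q q0; rewrite /interior.
exact: (C 0%N q Logic.I _ (open_near (@open_gt0 R) q0)).
Qed.

Lemma radius_gt0 q : axis_free q -> 0 < radius q.
Proof. by move=> q0; rewrite sqrtr_gt0. Qed.

Lemma smooth_radius : smooth axis_free radius.
Proof.
move=> k; apply: (Ck_comp open_axis_free (J := [set x : R | 0 < x])) => //.
  exact: smooth_sqrt.
have o := open_axis_free.
by apply: CkD => //; apply: CkM => //; exact: smooth_entry.
Qed.

Lemma smooth_radius_inv : smooth axis_free (fun q => (radius q)^-1).
Proof.
move=> k; apply: (Ck_comp open_axis_free (J := [set x : R | x != 0])).
- by move=> q /radius_gt0; exact: lt0r_neq0.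
- exact: smooth_inv.
- exact: smooth_radius.
Qed.

Lemma smooth_ratio i : smooth axis_free (fun q => q 0 i * (radius q)^-1).
Proof.
move=> k; apply: CkM; [exact: open_axis_free| |exact: smooth_radius_inv].
exact: smooth_entry open_axis_free k.
Qed.

Lemma open_cone : open cone.
Proof.
rewrite openE => q [q0 qJ]; rewrite /interior.
apply: filterI; first exact: open_near open_axis_free q0.
exact: (smooth_ratio 2 0%N q q0 _ (open_near open_slope qJ)).
Qed.

Definition tcoord (q : 'rV[R]_3) : R := slope_inv (q 0 2 * (radius q)^-1).

Lemma smooth_tcoord : smooth cone tcoord.
Proof.
move=> k; apply: (Ck_comp open_cone (J := slope @` I)).
- by move=> q [].
- exact: smooth_slope_inv.
- by apply: Ck_sub (smooth_ratio 2 k) => q [].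
Qed.

Lemma tcoord_mem q : cone q -> I (tcoord q).
Proof. by move=> [_ [t It tq]]; rewrite /tcoord -tq slopeK. Qed.

Section PhiAt.
Variable c : 'rV[R]_3.
Hypotheses (c0 : 0 < c 0 0) (Ic : I (c 0 1)).

Lemma radius_Phi : radius (Phi a b c) = c 0 0 * a (c 0 1).
Proof.
have r0 : 0 < c 0 0 * a (c 0 1) by rewrite mulr_gt0 // apos.
rewrite /radius /Phi !row3E; have := cos2Dsin2 (c 0 2).
move: (cos _) (sin _) => x y xy.
rewrite (_ : _ + _ = (c 0 0 * a (c 0 1)) ^+ 2).
  by rewrite sqrtr_sqr gtr0_norm.
by transitivity ((c 0 0 * a (c 0 1)) ^+ 2 * (x ^+ 2 + y ^+ 2));
  [ring|rewrite xy mulr1].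
Qed.

Lemma axis_free_Phi : axis_free (Phi a b c).
Proof.
have := radius_Phi; rewrite /radius /axis_free /= => E.
by rewrite -sqrtr_gt0 E mulr_gt0 // apos.
Qed.

Lemma ratio_Phi : [/\ Phi a b c 0 0 * (radius (Phi a b c))^-1 = cos (c 0 2),
  Phi a b c 0 1 * (radius (Phi a b c))^-1 = sin (c 0 2) &
  Phi a b c 0 2 * (radius (Phi a b c))^-1 = slope (c 0 1)].
Proof.
have c0' : c 0 0 != 0 by rewrite gt_eqF.
have a0' := aN0 Ic.
by rewrite radius_Phi /Phi !row3E /slope; split; field; rewrite c0' a0'.
Qed.

Lemma cone_Phi : cone (Phi a b c).
Proof.
by split; [exact: axis_free_Phi|have [_ _ ->] := ratio_Phi; exists (c 0 1)].
Qed.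

Lemma tcoord_Phi : tcoord (Phi a b c) = c 0 1.
Proof. by rewrite /tcoord; have [_ _ ->] := ratio_Phi; rewrite slopeK. Qed.

End PhiAt.

(** The chosen coordinates of a point agree with any others, up to a multiple of
    [2 pi] in [theta]. *)
Lemma coords_Phi (c : 'rV[R]_3) : 0 < c 0 0 -> I (c 0 1) ->
  [/\ coords I a b (Phi a b c) 0 0 = c 0 0,
  coords I a b (Phi a b c) 0 1 = c 0 1,
  cos (coords I a b (Phi a b c) 0 2) = cos (c 0 2) &
  sin (coords I a b (Phi a b c) 0 2) = sin (c 0 2)].
Proof.
move=> c0 Ic.
have [] : [set d : 'rV[R]_3 | [/\ 0 < d 0 0, I (d 0 1) & Phi a b d = Phi a b c]]
    (coords I a b (Phi a b c)) by apply: getPex; exists c.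
move: (coords I a b (Phi a b c)) => d d0 Id E.
have [C1 S1 _] := ratio_Phi d0 Id; have [C2 S2 _] := ratio_Phi c0 Ic.
have t1 : d 0 1 = c 0 1 by rewrite -(tcoord_Phi d0 Id) E tcoord_Phi.
split=> //; last 2 first.
- by rewrite -C1 -C2 E.
- by rewrite -S1 -S2 E.
have := radius_Phi d0 Id; rewrite E (radius_Phi c0 Ic) t1.
by move/(mulIf (aN0 Ic)).
Qed.

Lemma coneP q : cone q ->
  exists c : 'rV[R]_3, [/\ 0 < c 0 0, I (c 0 1) & Phi a b c = q].
Proof.
move=> [q0 [t It tq]]; have r0 := radius_gt0 q0; have r0' := lt0r_neq0 r0.
have a0 := apos It; have a0' := lt0r_neq0 a0.
have [|th [cth sth]] := @polar_angle R (q 0 0 / radius q) (q 0 1 / radius q).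
  have E : radius q ^+ 2 = q 0 0 * q 0 0 + q 0 1 * q 0 1.
    by rewrite sqr_sqrtr // ltW.
  transitivity ((q 0 0 * q 0 0 + q 0 1 * q 0 1) / radius q ^+ 2); first by field.
  by rewrite -E divff // expf_neq0.
exists (row3 (radius q / a t) t th); rewrite !row3E; split=> //.
  by rewrite divr_gt0.
apply: row3P; rewrite /Phi !row3E ?cth ?sth.
- by field; rewrite r0' a0'.
- by field; rewrite r0' a0'.
- transitivity (radius q * slope t); first by rewrite /slope; field.
  by rewrite tq; field.
Qed.

Lemma rho_Phi (c : 'rV[R]_3) : 0 < c 0 0 -> I (c 0 1) ->
  rho I a b (Phi a b c) = c 0 0.
Proof. by move=> c0 Ic; have [] := coords_Phi c0 Ic. Qed.

Lemma smooth_rho : smooth cone (rho I a b).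
Proof.
move=> k.
have : Ck k cone (fun q => radius q * (a (tcoord q))^-1).
  apply: CkM; first exact: open_cone.
    by apply: Ck_sub (smooth_radius k) => q [].
  apply: (Ck_comp open_cone (J := [set x : R | x != 0])).
  - by move=> q /tcoord_mem /aN0.
  - exact: smooth_inv.
  - exact: (Ck_comp open_cone tcoord_mem (sa k) (smooth_tcoord k)).
apply: Ck_ext open_cone _ => _ /coneP[c [c0 Ic <-]].
rewrite rho_Phi // radius_Phi // tcoord_Phi //.
by rewrite mulfK // aN0.
Qed.

Lemma differentiable_Phi (c : 'rV[R]_3) : I (c 0 1) -> differentiable (Phi a b) c.
Proof.
move=> Ic; have D i := differentiable_coord c 0 i.
have Da := differentiable_entry_comp (smooth_diff sa Ic).
have Db := differentiable_entry_comp (smooth_diff sb Ic).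
have Dc := differentiable_entry_comp (differentiable_cos (c 0 2)).
have Ds := differentiable_entry_comp (differentiable_sin (c 0 2)).
apply: differentiable_row3.
- exact: differentiableM (differentiableM (D 0) Da) Dc.
- exact: differentiableM (differentiableM (D 0) Da) Ds.
- exact: differentiableM (D 0) Db.
Qed.

(** The central projection [(rho, t, theta) |-> (t, theta)] onto [S]. *)
Definition chart_coords (c : 'rV[R]_3) : 'rV[R]_2 :=
  \row_(i < 2) (if i == 0 then c 0 1 else c 0 2).

Lemma chart_coordsE c : (chart_coords c 0 0 = c 0 1) * (chart_coords c 0 1 = c 0 2).
Proof. by rewrite !mxE. Qed.

Lemma Phi_derive (c h : 'rV[R]_3) : I (c 0 1) -> 'D_h (Phi a b) c
  = h 0 0 *: chart a b (chart_coords c)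
    + (h 0 1 * c 0 0) *: meridian a b (chart_coords c)
    + (h 0 2 * c 0 0 * a (c 0 1)) *: parallel (chart_coords c).
Proof.
move=> Ic.
have H0 := is_derive_entry c h 0.
have Ha := is_derive_entry_comp h (smooth_diff sa Ic).
have Hb := is_derive_entry_comp h (smooth_diff sb Ic).
have Hc := is_derive_entry_comp h (differentiable_cos (c 0 2)).
have Hs := is_derive_entry_comp h (differentiable_sin (c 0 2)).
have H0a := is_derive_mul H0 Ha.
have [_ E] := is_derive_row3 (is_derive_mul H0a Hc) (is_derive_mul H0a Hs)
  (is_derive_mul H0 Hb).
rewrite [LHS]E chartE /meridian /parallel !mxE /=.
by apply: row3P; rewrite row3E !(mxE, row3E) /= ?derive1_cos ?derive1_sin; ring.
Qed.

Lemma E1_Phi (c : 'rV[R]_3) : 0 < c 0 0 -> I (c 0 1) ->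
  E1 I a b (Phi a b c) = meridian a b (chart_coords c).
Proof.
move=> c0 Ic; have [e0 e1 e2 e3] := coords_Phi c0 Ic.
rewrite /E1 rho_Phi // Phi_derive ?e1 // !mxE /= scale0r add0r !mul0r scale0r.
rewrite addr0 mul1r e0 scalerA mulVf ?gt_eqF // scale1r.
by rewrite /meridian !chart_coordsE e1 e2 e3.
Qed.

Lemma E2_Phi (c : 'rV[R]_3) : 0 < c 0 0 -> I (c 0 1) ->
  E2 I a b (Phi a b c) = parallel (chart_coords c).
Proof.
move=> c0 Ic; have [e0 e1 e2 e3] := coords_Phi c0 Ic; have a0 := aN0 Ic.
rewrite /E2 rho_Phi // Phi_derive ?e1 // !mxE /= scale0r add0r !mul0r scale0r.
rewrite add0r mul1r e0 ?e1 scalerA mulrC (mulrC (a _)) mulfV; last first.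
  by rewrite mulf_neq0 // gt_eqF.
rewrite scale1r.
by rewrite /parallel !chart_coordsE e2 e3.
Qed.

Lemma smooth_E1 : smooth cone (E1 I a b).
Proof.
move=> k; have oc := open_cone.
have R_ i : Ck k cone (fun q => q 0 i * (radius q)^-1).
  by apply: Ck_sub (smooth_ratio i k) => q [].
have Da := Ck_comp oc tcoord_mem (smooth_derive1 sa k) (smooth_tcoord k).
have Db := Ck_comp oc tcoord_mem (smooth_derive1 sb k) (smooth_tcoord k).
apply: Ck_mx => // i; rewrite ord1 {i}; apply: forall_ord3.
- apply: Ck_ext oc _ (CkM oc Da (R_ 0)) => _ /coneP[c [c0 Ic <-]].
  rewrite E1_Phi // /meridian row3E /= tcoord_Phi //.
  by have [-> _ _] := ratio_Phi c0 Ic; rewrite !mxE.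
- apply: Ck_ext oc _ (CkM oc Da (R_ 1)) => _ /coneP[c [c0 Ic <-]].
  rewrite E1_Phi // /meridian row3E /= tcoord_Phi //.
  by have [_ -> _] := ratio_Phi c0 Ic; rewrite !mxE.
- apply: Ck_ext oc _ Db => _ /coneP[c [c0 Ic <-]].
  by rewrite E1_Phi // /meridian row3E /= tcoord_Phi // !mxE.
Qed.

End Coordinates.

(** * The gradient of the radial coordinate *)

Section SmoothFields.
Context {R : realType} {n : nat}.
Variable U : set 'rV[R]_n.
Hypothesis oU : open U.
Implicit Types (X Y : 'rV[R]_n -> 'rV[R]_n) (f : 'rV[R]_n -> R).

Lemma smooth_dot X Y : smooth U X -> smooth U Y ->
  smooth U (fun q => dot (X q) (Y q)).
Proof.
move=> sX sY k; apply: Ck_sum => // i; apply: CkM => //; exact: Ck_coord.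
Qed.

Lemma smooth_scale f X : smooth U f -> smooth U X -> smooth U (fun q => f q *: X q).
Proof.
move=> sf sX k; apply: Ck_mx => // i j; rewrite ord1.
apply: (Ck_ext oU _ (CkM oU (sf k) (Ck_coord 0 j oU (sX k)))) => q _.
by rewrite mxE.
Qed.

Lemma smooth_d0 f : smooth U f -> smooth U (d0 f).
Proof.
move=> sf k; apply: Ck_mx => // i j; rewrite ord1.
rewrite (_ : (fun _ => _) = 'D_(delta_mx 0 j) f).
  by case: (sf k.+1) => _; exact.
by apply/funext => q; rewrite mxE.
Qed.

Lemma smooth_d1 X : smooth U X -> smooth U (d1 X).
Proof.
move=> sX k; apply: Ck_mx => // i j.
have P l m : Ck k U (partial l (fun y => X y 0 m)).
  by have [_] := Ck_coord 0 m oU (sX k.+1); exact.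
apply: (Ck_ext oU _ (CkD oU (P i j) (CkM oU (@Ck_cst R _ R k U (-1)) (P j i)))) => q _.
by rewrite mxE mulN1r.
Qed.

End SmoothFields.

Section UnitGradient.
Context {R : realType} {n : nat}.
Variables (f : 'rV[R]_n -> R) (q : 'rV[R]_n).
Hypothesis df : \forall z \near q, differentiable f z.
Hypothesis ddf : differentiable (d0 f) q.
Let nu z := enorm (d0 f z).
Let N z := (nu z)^-1 *: d0 f z.
Hypothesis nu0 : 0 < nu q.

Lemma is_derive_enorm u :
  is_derive q u nu (dot ('D_u (d0 f) q) (N q)).
Proof.
have nuN0 : nu q != 0 by rewrite gt_eqF.
have Hg := derivableP (diff_derivable ddf (v := u)).
have g0 : 0 < dot (d0 f q) (d0 f q) by rewrite -sqrtr_gt0.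
have Hd := is_derive_dot Hg Hg.
have Hs := is_derive1_sqrt g0.
have Dd : differentiable (fun z => dot (d0 f z) (d0 f z)) q.
  rewrite (_ : (fun _ => _) = \sum_i (fun z => d0 f z 0 i) * (fun z => d0 f z 0 i)).
    apply: differentiable_sum => i.
    by apply: differentiableM; exact: (differentiable_mxP _ _).1.
  by apply/funext => z; rewrite fct_sumE.
have Ds : differentiable Num.sqrt (dot (d0 f q) (d0 f q)).
  by apply/derivable1_diffP; case: Hs.
have := is_derive_comp1 Dd Hd Ds.
rewrite derive1E; have [_ ->] := Hs; congr (is_derive _ _ _ _).
rewrite /N dotZr [dot (d0 f q) ('D_u _ _)]dotC -/(enorm (d0 f q)) -/(nu q).
move: (dot _ _) => w; by field.
Qed.

Lemma is_derive_unit_gradient u : is_derive q u N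
  ((nu q)^-1 *: ('D_u (d0 f) q - dot ('D_u (d0 f) q) (N q) *: N q)).
Proof.
have nuN0 : nu q != 0 by rewrite gt_eqF.
have Hg := derivableP (diff_derivable ddf (v := u)).
have Hn := is_derive_enorm u.
apply: is_derive_mx => i j; rewrite ord1.
have Hi := is_derive_inv nuN0 Hn.
have -> : (fun y => N y 0 j) = (fun y => (nu y)^-1 * d0 f y 0 j).
  by apply/funext => y; rewrite mxE.
have := is_derive_mul Hi (is_derive_coord 0 j Hg); congr (is_derive _ _ _ _).
rewrite !mxE -/(nu q).
move: (dot _ _) ('D_u (d0 f) q 0 j) ('D_(delta_mx 0 j) f q) => w g d.
by rewrite /partial; field.
Qed.

(** Symmetry of the Hessian [H] of [f]: both sides are [H (N, e) / |grad f|]. So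
    the normal field of the level sets turns, along itself, by the tangential
    gradient of [log |grad f|]. *)
Lemma unit_gradient_derive e : dot e (N q) = 0 ->
  dot ('D_(N q) N q) e = (nu q)^-1 * 'D_e nu q.
Proof.
move=> eN; have [_ ->] := is_derive_unit_gradient (N q).
have [_ ->] := is_derive_enorm e.
rewrite dotZl dotBl dotZl (dotC (N q) e) eN mulr0 subr0; congr (_ * _).
rewrite !derive_jac // dot_mulmx dotC.
have := d1_d0 df ddf; rewrite d1E => /eqP; rewrite subr_eq0 => /eqP <-.
by [].
Qed.

Lemma unit_gradient_dot : dot (N q) (N q) = 1.
Proof.
have nuN0 : nu q != 0 by rewrite gt_eqF.
rewrite /N dotZl dotZr mulrA -expr2 exprVn -[dot _ _]sqr_sqrtr ?dotvv_ge0 //.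
by rewrite mulVf // expf_neq0.
Qed.

Lemma unit_gradient_derive_dot u : dot ('D_u N q) (N q) = 0.
Proof.
have [_ ->] := is_derive_unit_gradient u.
by rewrite dotZl dotBl dotZl unit_gradient_dot mulr1 subrr mulr0.
Qed.

End UnitGradient.

Section NormalField.
Context {R : realType}.
Variables (I : set R) (a b : R -> R).
Hypotheses (oI : open I) (itvI : is_interval I).
Hypotheses (sa : smooth I a) (sb : smooth I b).
Hypothesis apos : forall t, I t -> 0 < a t.
Hypothesis det : forall t, I t -> b t * derive1 a t - a t * derive1 b t != 0.
Hypothesis us : unit_speed I a b.

Let D t := b t * derive1 a t - a t * derive1 b t.
Let oC : open (cone I a b). Proof. exact: open_cone. Qed.
Let sR : smooth (cone I a b) (rho I a b). Proof. exact: smooth_rho. Qed.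

Section At.
Variable c : 'rV[R]_3.
Hypotheses (c0 : 0 < c 0 0) (Ic : I (c 0 1)).

Let Cc : cone I a b (Phi a b c). Proof. exact: cone_Phi. Qed.

(** Differentiating [rho (Phi c) = c 0 0] pairs the gradient of [rho] with
    the coordinate fields, which determines it. *)
Lemma grad_rho_derive h :
  dot ('D_h (Phi a b) c) (grad (rho I a b) (Phi a b c)) = h 0 0.
Proof.
have dPhi := differentiable_Phi sa sb Ic.
have drho := smooth_diff sR Cc.
rewrite -[grad _ _]/(d0 _ _) -(derive_d0 _ drho) -(derive_chain h dPhi drho).
have [_ <-] := is_derive_entry c h 0.
apply: near_eq_derive.
have N0 : \forall d \near c, 0 < (d : 'rV[R]_3) 0 0.
  exact: (@coord_continuous R 1 3 0 0 c _ (open_near (@open_gt0 R) c0)).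
have N1 : \forall d \near c, I ((d : 'rV[R]_3) 0 1).
  exact: (@coord_continuous R 1 3 0 1 c _ (open_near oI Ic)).
apply: filterS2 N0 N1 => d d0 Id; exact: rho_Phi.
Qed.

(** The gradient is orthogonal to the meridian and the parallel, and the radial
    coordinate field fixes its length. *)
Lemma grad_rho_Phi :
  grad (rho I a b) (Phi a b c) = - (D (c 0 1))^-1 *: normal a b (chart_coords c).
Proof.
have ut : derive1 a (chart_coords c 0 0) ^+ 2 + derive1 b (chart_coords c 0 0) ^+ 2 = 1.
  by rewrite chart_coordsE; exact: us.
have c0' : c 0 0 != 0 by rewrite gt_eqF.
have a0' : a (c 0 1) != 0 by rewrite gt_eqF // apos.
have G0 := grad_rho_derive (delta_mx 0 0).
have G1 := grad_rho_derive (delta_mx 0 1).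
have G2 := grad_rho_derive (delta_mx 0 2).
move: G0 G1 G2; rewrite !(Phi_derive sa sb _ Ic) !mxE /= !scale0r !mul0r !scale0r.
rewrite !(scale0r, mul1r, mul0r, add0r, addr0, scale1r) !dotZl => G0.
move=> /eqP; rewrite mulf_eq0 (negbTE c0') /= => /eqP G1.
move=> /eqP; rewrite !mulf_eq0 (negbTE c0') (negbTE a0') /= => /eqP G2.
set g := grad _ _ in G0 G1 G2 *.
have gE := frame_expand g (frame_dot ut).
rewrite (dotC g) G1 (dotC g) G2 !scale0r !add0r in gE.
rewrite {1}gE; congr (_ *: _).
move: G0; rewrite {1}gE dotZr dot_chart_normal !chart_coordsE => G0.
have D0 : D (c 0 1) != 0 by exact: det.
apply: (mulIf D0); rewrite [RHS]mulNr mulVf // [D _](_ : _ =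
  - (a (c 0 1) * derive1 b (c 0 1) - b (c 0 1) * derive1 a (c 0 1))).
  by rewrite mulrN G0.
by rewrite /D; ring.
Qed.

Lemma grad_norm_Phi : grad_norm I a b (Phi a b c) = `|D (c 0 1)|^-1.
Proof.
have ut : derive1 a (chart_coords c 0 0) ^+ 2 + derive1 b (chart_coords c 0 0) ^+ 2 = 1.
  by rewrite chart_coordsE; exact: us.
have [_ _ nn _] := frame_dot ut.
rewrite /grad_norm grad_rho_Phi /enorm dotZl dotZr nn mulr1 -expr2 sqrtr_sqr.
by rewrite normrN normfV.
Qed.

Lemma grad_norm_Phi_gt0 : 0 < grad_norm I a b (Phi a b c).
Proof. by rewrite grad_norm_Phi invr_gt0 normr_gt0; exact: det. Qed.

Lemma Nfield_Phi : exists s, Nfield I a b (Phi a b c) = s *: normal a b (chart_coords c).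
Proof. by eexists; rewrite /Nfield grad_rho_Phi scalerA. Qed.

End At.

Lemma grad_norm_gt0 q : cone I a b q -> 0 < grad_norm I a b q.
Proof. by move=> /(coneP apos)[c [c0 Ic <-]]; exact: grad_norm_Phi_gt0. Qed.

Lemma smooth_grad_norm : smooth (cone I a b) (grad_norm I a b).
Proof.
move=> k; apply: (Ck_comp oC (J := [set x : R | 0 < x])).
- by move=> q /grad_norm_gt0; rewrite /grad_norm /enorm sqrtr_gt0.
- exact: smooth_sqrt.
- by apply: smooth_dot => //; exact: smooth_d0.
Qed.

Lemma smooth_grad_norm_inv : smooth (cone I a b) (fun q => (grad_norm I a b q)^-1).
Proof.
move=> k; apply: (Ck_comp oC (J := [set x : R | x != 0])).
- by move=> q /grad_norm_gt0; exact: lt0r_neq0.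
- exact: smooth_inv.
- exact: smooth_grad_norm.
Qed.

Lemma smooth_Nfield : smooth (cone I a b) (Nfield I a b).
Proof.
by apply: smooth_scale => //; [exact: smooth_grad_norm_inv|exact: smooth_d0].
Qed.

Lemma smooth_E1_grad_norm : smooth (cone I a b) (E1_grad_norm I a b).
Proof.
move=> k.
have S := smooth_dot oC (smooth_E1 oI itvI sa sb apos det)
  (smooth_d0 oC smooth_grad_norm).
apply: (Ck_ext oC _ (S k)) => q Cq.
by rewrite /E1_grad_norm (derive_d0 _ (smooth_diff smooth_grad_norm Cq)).
Qed.

End NormalField.

(** * The frame and the curvatures of the surface *)

Section ChartFrame.
Context {R : realType}.
Variables (I : set R) (a b : R -> R).
Hypotheses (oI : open I) (itvI : is_interval I).
Hypotheses (sa : smooth I a) (sb : smooth I b).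
Hypothesis apos : forall t, I t -> 0 < a t.
Hypothesis det : forall t, I t -> b t * derive1 a t - a t * derive1 b t != 0.
Hypothesis us : unit_speed I a b.

Local Notation X := (chart a b).
Local Notation T := (meridian a b).
Local Notation E := (@parallel R).
Local Notation N := (Nfield I a b).
Local Notation nu := (grad_norm I a b).

Let oC : open (cone I a b). Proof. exact: open_cone. Qed.
Let sN : smooth (cone I a b) N. Proof. exact: smooth_Nfield. Qed.
Let snu : smooth (cone I a b) nu. Proof. exact: smooth_grad_norm. Qed.

Lemma near_chart_mem (y : 'rV[R]_2) : I (y 0 0) ->
  \forall z \near y, I ((z : 'rV[R]_2) 0 0).
Proof.
by move=> Iy; exact: (@coord_continuous R 1 2 0 0 y _ (open_near oI Iy)).
Qed.

Section Point.
Variable y : 'rV[R]_2.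
Hypothesis Iy : I (y 0 0).

Let c : 'rV[R]_3 := row3 1 (y 0 0) (y 0 1).
Let c0 : 0 < c 0 0. Proof. by rewrite row3E. Qed.
Let Ic : I (c 0 1). Proof. by rewrite row3E. Qed.
Let chart_coordsc : chart_coords c = y.
Proof. by apply/rowP; apply: forall_ord2; rewrite mxE /= row3E. Qed.

Lemma cone_chart : cone I a b (X y). Proof. exact: cone_Phi c0 Ic. Qed.

Lemma E1_chart : E1 I a b (X y) = T y.
Proof. by rewrite -[in RHS]chart_coordsc; exact: E1_Phi c0 Ic. Qed.

Lemma E2_chart : E2 I a b (X y) = E y.
Proof. by rewrite -[in RHS]chart_coordsc; exact: E2_Phi c0 Ic. Qed.

Lemma grad_norm_chart :
  nu (X y) = `|b (y 0 0) * derive1 a (y 0 0) - a (y 0 0) * derive1 b (y 0 0)|^-1.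
Proof.
have := grad_norm_Phi oI itvI sa sb apos det us c0 Ic.
by rewrite !row3E.
Qed.

Lemma Nfield_chart : exists s, N (X y) = s *: normal a b y.
Proof.
have [s Es] := Nfield_Phi oI itvI sa sb apos det us c0 Ic.
by exists s; rewrite -[in RHS]chart_coordsc; exact: Es.
Qed.

Lemma nu_gt0 : 0 < nu (X y).
Proof. by apply: grad_norm_gt0 => //; exact: cone_chart. Qed.

Let frame_y := frame_dot (a := a) (b := b) (us Iy).

Lemma Nfield_unit : dot (N (X y)) (N (X y)) = 1.
Proof. exact: (unit_gradient_dot (f := rho I a b) nu_gt0). Qed.

Lemma frame_chart : orthonormal3 (T y) (E y) (N (X y)).
Proof.
have [TT EE nn [TE Tn En]] := frame_y; have [s Es] := Nfield_chart.
split=> //; first exact: Nfield_unit.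
by split=> //; rewrite Es dotZr ?Tn ?En mulr0.
Qed.

Lemma induced_metric_chart : induced_metric X y = warped (a (y 0 0)).
Proof.
have [TT EE nn [TE Tn En]] := frame_y.
apply/matrixP; apply: forall_ord2; apply: forall_ord2;
  rewrite !mxE ?(chart_dt sa sb Iy) ?(chart_dtheta sa sb Iy)
    ?dotZl ?dotZr ?TT ?EE ?TE ?(dotC _ (T y)) ?TE /= ?mulr0 ?mulr1 ?mulr1n ?mulr0n //.
Qed.

Lemma pullback_chart w : pullback X w y 0 0 = dot (w (X y)) (T y) /\
  pullback X w y 0 1 = a (y 0 0) * dot (w (X y)) (E y).
Proof.
by rewrite !mxE (chart_dt sa sb Iy) (chart_dtheta sa sb Iy) -dotZr.
Qed.

Lemma derive_chart (W : normedModType R) (F : 'rV[R]_3 -> W) :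
  differentiable F (X y) ->
  'D_(delta_mx 0 0) (F \o X) y = 'D_(T y) F (X y) /\
  'D_(delta_mx 0 1) (F \o X) y = a (y 0 0) *: 'D_(E y) F (X y).
Proof.
move=> dF; have dX := differentiable_chart sa sb Iy.
rewrite !(derive_chain _ dX dF) (chart_dt sa sb Iy) (chart_dtheta sa sb Iy).
by split=> //; exact: derive_linE.
Qed.

Lemma meridian_dt_normal :
  'D_(delta_mx 0 0) T y = dot ('D_(delta_mx 0 0) T y) (N (X y)) *: N (X y).
Proof.
have [TT EE NN [TE TN EN]] := frame_chart.
have HT := derivableP (diff_derivable (differentiable_meridian sa sb Iy)
  (v := delta_mx 0 0)).
have T1 : dot ('D_(delta_mx 0 0) T y) (T y) = 0.
  have [_ H] := is_derive_dot HT HT.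
  have : 'D_(delta_mx 0 0) (fun z => dot (T z) (T z)) y = 0.
    rewrite -(derive_cst (1 : R) y (delta_mx 0 0)); apply: near_eq_derive.
    apply: filterS (near_chart_mem Iy) => z Iz.
    by have [] := frame_dot (a := a) (b := b) (us Iz).
  by rewrite H (dotC (T y)); lra.
have T2 : dot ('D_(delta_mx 0 0) T y) (E y) = 0.
  rewrite (meridian_dt sa sb Iy) /parallel dot3E !row3E.
  by move: (derive1 _ _) (derive1 _ _) (cos _) (sin _) => d1 d2 co si; ring.
have G := frame_expand ('D_(delta_mx 0 0) T y) frame_chart.
by rewrite {1}G T1 T2 !scale0r !add0r.
Qed.

Lemma parallel_dt : 'D_(delta_mx 0 0) E y = 0.
Proof. by rewrite derive_parallel mxE /= oppr0 scale0r. Qed.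

Lemma parallel_dtheta_dot : dot ('D_(delta_mx 0 1) E y) (T y) = - derive1 a (y 0 0)
  /\ dot ('D_(delta_mx 0 1) E y) (E y) = 0.
Proof.
rewrite derive_parallel mxE /= scaleN1r !dotNl /meridian /parallel !dot3E !row3E.
have := cos2Dsin2 (y 0 1); move: (cos _) (sin _) => u w uw.
split; last by ring.
by transitivity (- (derive1 a (y 0 0) * (u ^+ 2 + w ^+ 2))); [ring|rewrite uw mulr1].
Qed.

Lemma parallel_dtheta : 'D_(delta_mx 0 1) E y =
  - derive1 a (y 0 0) *: T y + dot ('D_(delta_mx 0 1) E y) (N (X y)) *: N (X y).
Proof.
have [TT EE NN [TE TN EN]] := frame_chart.
have [P1 P2] := parallel_dtheta_dot.
have G := frame_expand ('D_(delta_mx 0 1) E y) frame_chart.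
by rewrite {1}G P1 P2 scale0r addr0.
Qed.

Let dNX : differentiable (N \o X) y.
Proof.
exact: differentiable_comp (differentiable_chart sa sb Iy) (smooth_diff sN cone_chart).
Qed.

(** Weingarten's equation, from the derivative of [dot F N = 0] along [S]. *)
Lemma derive_dot_normal (F : 'rV[R]_2 -> 'rV[R]_3) (h : 'rV[R]_2) :
  (forall z : 'rV[R]_2, I (z 0 0) -> dot (F z) (N (X z)) = 0) -> differentiable F y ->
  dot ('D_h F y) (N (X y)) = - dot (F y) ('D_h (N \o X) y).
Proof.
move=> F0 dF; have HF := derivableP (diff_derivable dF (v := h)).
have HN := derivableP (diff_derivable dNX (v := h)).
have [_ H] := is_derive_dot HF HN.
have : 'D_h (fun z => dot (F z) ((N \o X) z)) y = 0.
  rewrite -(derive_cst (0 : R) y h); apply: near_eq_derive.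
  by apply: filterS (near_chart_mem Iy) => z; exact: F0.
by rewrite H /=; lra.
Qed.

End Point.

(** By rotational symmetry, [|grad rho|] on [S] depends on [t] only. *)
Lemma derive_nu_parallel (y : 'rV[R]_2) : I (y 0 0) -> 'D_(E y) nu (X y) = 0.
Proof.
move=> Iy.
have [_ H] := derive_chart Iy (smooth_diff snu (cone_chart Iy)).
have : 'D_(delta_mx 0 1) (nu \o X) y = 0.
  pose g t := `|b t * derive1 a t - a t * derive1 b t|^-1.
  transitivity ('D_(delta_mx 0 1) (fun z : 'rV[R]_2 => g (z 0 0)) y).
    apply: near_eq_derive; apply: filterS (near_chart_mem Iy) => z Iz.
    exact: (grad_norm_chart Iz).
  by apply: derive_entry0; rewrite mxE.
by rewrite H => /eqP; rewrite scaler_eq0 gt_eqF ?apos //= => /eqP.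
Qed.

Section Curvatures.
Variable y : 'rV[R]_2.
Hypothesis Iy : I (y 0 0).
Variables k1 k2 : R.
Hypothesis hk1 : 'D_(T y) N (X y) = - k1 *: T y.
Hypothesis hk2 : 'D_(E y) N (X y) = - k2 *: E y.

(** The meridian is a geodesic of [S], so that it turns in the normal direction
    only. *)
Lemma meridian_curvature : 'D_(delta_mx 0 0) T y = k1 *: N (X y).
Proof.
have dT := differentiable_meridian sa sb Iy.
have F0 (z : 'rV[R]_2) : I (z 0 0) -> dot (T z) (N (X z)) = 0.
  by move=> Iz; have [_ _ _ []] := frame_chart Iz.
rewrite (meridian_dt_normal Iy) (derive_dot_normal Iy _ F0 dT).
have [-> _] := derive_chart Iy (smooth_diff sN (cone_chart Iy)).
have [TT _ _ _] := frame_chart Iy.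
by rewrite hk1 dotZr TT mulr1 opprK.
Qed.

(** The parallel turns towards the axis: partly along [S], with geodesic
    curvature [a' / a], and partly along the normal. *)
Lemma parallel_curvature : 'D_(delta_mx 0 1) E y =
  - derive1 a (y 0 0) *: T y + (a (y 0 0) * k2) *: N (X y).
Proof.
have dE := differentiable_parallel y.
have F0 (z : 'rV[R]_2) : I (z 0 0) -> dot (E z) (N (X z)) = 0.
  by move=> Iz; have [_ _ _ []] := frame_chart Iz.
rewrite {1}(parallel_dtheta Iy) (derive_dot_normal Iy _ F0 dE).
have [_ ->] := derive_chart Iy (smooth_diff sN (cone_chart Iy)).
have [_ EE _ _] := frame_chart Iy.
rewrite hk2 !dotZr EE; congr (_ + _ *: _); ring.
Qed.

End Curvatures.

End ChartFrame.

(** * Divergence free fields tangent to the surface *)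

Section TangentField.
Context {R : realType}.
Variables (I : set R) (a b : R -> R).
Hypotheses (oI : open I) (itvI : is_interval I).
Hypotheses (sa : smooth I a) (sb : smooth I b).
Hypothesis apos : forall t, I t -> 0 < a t.
Hypothesis det : forall t, I t -> b t * derive1 a t - a t * derive1 b t != 0.
Hypothesis us : unit_speed I a b.
Variables (U : set 'rV[R]_3) (v : 'rV[R]_3 -> 'rV[R]_3).
Hypotheses (oU : open U) (sv : smooth U v).
Hypothesis hdiv : forall q, U q -> divergence euclid v q = 0.

Local Notation X := (chart a b).
Local Notation T := (meridian a b).
Local Notation E := (@parallel R).
Local Notation N := (Nfield I a b).
Local Notation nu := (grad_norm I a b).
Local Notation C := (cone I a b).

Hypothesis vn : forall y : 'rV[R]_2, I (y 0 0) -> U (X y) ->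
  dot (v (X y)) (normal a b y) = 0.
Hypothesis divS : forall y : 'rV[R]_2, I (y 0 0) -> U (X y) ->
  divergence (induced_metric X) (sharp (induced_metric X) (pullback X v)) y = 0.

Let oC : open C. Proof. exact: open_cone. Qed.
Let sN : smooth C N. Proof. exact: smooth_Nfield. Qed.
Let snu : smooth C nu. Proof. exact: smooth_grad_norm. Qed.
Let sE1 : smooth C (E1 I a b). Proof. exact: smooth_E1. Qed.

Lemma near_chart (y : 'rV[R]_2) : I (y 0 0) -> U (X y) ->
  \forall z \near y, I ((z : 'rV[R]_2) 0 0) /\ U (X z).
Proof.
move=> Iy Uy; apply: filterI; first exact: near_chart_mem.
have dX := differentiable_chart sa sb Iy.
exact: (differentiable_continuous dX (open_near oU Uy)).
Qed.

(** The derivative of [log |grad rho|] along the meridian. *)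
Definition kappa q := E1_grad_norm I a b q / nu q.
Definition normal_part q := dot (N q) (v q).
(** [dot v (D_N N)], extended to a neighbourhood of [S] by the vectors [E1]. *)
Definition turning q := kappa q * dot (v q) (E1 I a b q).

Section Point.
Variable y : 'rV[R]_2.
Hypotheses (Iy : I (y 0 0)) (Uy : U (X y)).

Let Cy : C (X y). Proof. exact: cone_chart. Qed.
Let dv : differentiable v (X y). Proof. exact: smooth_diff sv Uy. Qed.
Let dN : differentiable N (X y). Proof. exact: smooth_diff sN Cy. Qed.
Let dX := differentiable_chart sa sb Iy.
Let fr : orthonormal3 (T y) (E y) (N (X y)). Proof. exact: frame_chart. Qed.
Let a0 : a (y 0 0) != 0. Proof. by rewrite gt_eqF // apos. Qed.

Lemma dot_field_normal : dot (v (X y)) (N (X y)) = 0.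
Proof.
have [s ->] := Nfield_chart oI itvI sa sb apos det us Iy.
by rewrite dotZr vn // mulr0.
Qed.

Lemma near_warped : \forall z \near y, 0 < a ((z : 'rV[R]_2) 0 0) /\
  induced_metric X z = warped (a (z 0 0)).
Proof.
apply: filterS (near_chart_mem oI Iy) => z Iz; split; first exact: apos.
exact: (induced_metric_chart sa sb us Iz).
Qed.

(** For a field tangent to [S], the divergence along [S] is the tangential part
    of the trace of the derivative in space. *)
Lemma surface_divergence :
  dot ('D_(T y) v (X y)) (T y) + dot ('D_(E y) v (X y)) (E y) = 0.
Proof.
have [TT EE NN [TE TN EN]] := fr.
have dvX : differentiable (v \o X) y := differentiable_comp dX dv.
have dT := differentiable_meridian sa sb Iy.
have dE := @differentiable_parallel R y.
have [V0 V1] := derive_chart sa sb Iy dv.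
pose h0 : 'rV[R]_2 := delta_mx 0 0; pose h1 : 'rV[R]_2 := delta_mx 0 1.
have HV0 := derivableP (diff_derivable dvX (v := h0)).
have HV1 := derivableP (diff_derivable dvX (v := h1)).
have HT := derivableP (diff_derivable dT (v := h0)).
have HE := derivableP (diff_derivable dE (v := h1)).
have Ha := is_derive_entry_comp h0 (smooth_diff sa Iy).
have [_ D0] := is_derive_mul Ha (is_derive_dot HV0 HT).
have [_ D1] := is_derive_dot HV1 HE.
have := divS Iy Uy; rewrite (div_warped _ near_warped).
have -> : partial 0 (fun z : 'rV[R]_2 => a (z 0 0) * pullback X v z 0 0) y
    = 'D_h0 (fun z : 'rV[R]_2 => a (z 0 0) * dot ((v \o X) z) (T z)) y.
  apply: near_eq_derive; apply: filterS (near_chart_mem oI Iy) => z Iz.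
  by have [-> _] := pullback_chart sa sb Iz v.
have -> : partial 1 (fun z : 'rV[R]_2 => pullback X v z 0 1 / a (z 0 0)) y
    = 'D_h1 (fun z => dot ((v \o X) z) (E z)) y.
  apply: near_eq_derive; apply: filterS (near_chart_mem oI Iy) => z Iz.
  have [_ ->] := pullback_chart sa sb Iz v.
  by rewrite mulrAC mulfV ?mul1r // gt_eqF // apos.
have S0 : dot (v (X y)) ('D_h0 T y) = 0.
  rewrite (meridian_dt_normal oI itvI sa sb apos det us Iy).
  by rewrite (dotZr _ (v (X y))) dot_field_normal mulr0.
have S1 : dot (v (X y)) ('D_h1 E y)
    = - derive1 a (y 0 0) * dot (v (X y)) (T y).
  rewrite (parallel_dtheta oI itvI sa sb apos det us Iy) dotDr.
  rewrite (dotZr (- _)) (dotZr _ (v (X y)) (N (X y))).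
  by rewrite dot_field_normal mulr0 addr0.
have h00 : h0 0 0 = 1 by rewrite mxE.
have {}D0 : 'D_h0 (fun z : 'rV[R]_2 => a (z 0 0) * dot ((v \o X) z) (T z)) y
    = derive1 a (y 0 0) * dot (v (X y)) (T y)
      + a (y 0 0) * dot ('D_(T y) v (X y)) (T y).
  by rewrite D0 h00 mul1r V0 [dot ((v \o X) y) ('D_h0 T y)]S0 addr0.
have {}D1 : 'D_h1 (fun z => dot ((v \o X) z) (E z)) y
    = a (y 0 0) * dot ('D_(E y) v (X y)) (E y)
      - derive1 a (y 0 0) * dot (v (X y)) (T y).
  by rewrite D1 V1 [dot ((v \o X) y) ('D_h1 E y)]S1 dotZl mulNr.
have K (A d p p1 p2 : R) : A != 0 ->
    A^-1 * ((d * p + A * p1) + (A * p2 - d * p)) = 0 -> p1 + p2 = 0.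
  by move=> A0 <-; field.
by rewrite D0 D1; exact: K.
Qed.

(** The difference between the divergences in space and along [S]. *)
Lemma derive_normal_dot : dot ('D_(N (X y)) v (X y)) (N (X y)) = 0.
Proof.
have := hdiv Uy; rewrite divergence_euclid (mxtrace_frame3 _ fr).
by rewrite -!(derive_jac _ dv) surface_divergence add0r.
Qed.

(** [unit_gradient_derive] for [rho], whose [|grad rho|] varies along the
    meridians only. *)
Lemma derive_normal_normal :
  'D_(N (X y)) N (X y) = kappa (X y) *: T y.
Proof.
have [TT EE NN [TE TN EN]] := fr.
have srho := smooth_rho oI itvI sa sb apos det.
have dr : \forall z \near X y, differentiable (rho I a b) z.
  by apply: filterS (open_near oC Cy) => z Cz; exact: smooth_diff srho Cz.
have ddr : differentiable (d0 (rho I a b)) (X y).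
  exact: smooth_diff (smooth_d0 oC srho) Cy.
have nu0 := nu_gt0 oI itvI sa sb apos det us Iy.
have G := frame_expand ('D_(N (X y)) N (X y)) fr.
have G1 : dot ('D_(N (X y)) N (X y)) (T y) = (nu (X y))^-1 * 'D_(T y) nu (X y).
  exact: (unit_gradient_derive dr ddr nu0 TN).
have G2 : dot ('D_(N (X y)) N (X y)) (E y) = (nu (X y))^-1 * 'D_(E y) nu (X y).
  exact: (unit_gradient_derive dr ddr nu0 EN).
have G3 : dot ('D_(N (X y)) N (X y)) (N (X y)) = 0.
  exact: (unit_gradient_derive_dot ddr nu0).
rewrite {1}G G1 G2 G3 (derive_nu_parallel oI itvI sa sb apos det us Iy).
rewrite mulr0 !scale0r !addr0 /kappa /E1_grad_norm.
by rewrite (E1_chart oI itvI sa sb apos det Iy) mulrC.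
Qed.

(** Although the normal component of [v] vanishes on [S], its normal derivative
    does not: the derivative of [v] along [N] is tangential, but [N] turns. *)
Lemma derive_normal_part :
  dot (N (X y)) (d0 normal_part (X y)) = turning (X y).
Proof.
rewrite (d0_dot dN dv) dotDr -!dot_mulmx -(derive_jac _ dv) -(derive_jac _ dN).
rewrite derive_normal_dot derive_normal_normal add0r dotZl /turning.
by rewrite (E1_chart oI itvI sa sb apos det Iy) dotC.
Qed.

End Point.

End TangentField.

(** * The two Laplacians *)

Section LieForms.
Context {R : realType} {n : nat}.
Implicit Types (X w v : 'rV[R]_n -> 'rV[R]_n) (q u : 'rV[R]_n).

Lemma d1_derive_antisym v q u : differentiable (d1 v) q ->
  ('D_u (d1 v) q)^T = - 'D_u (d1 v) q.
Proof.
move=> dd; have D := diff_derivable dd (v := u).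
apply/matrixP => i j; rewrite !mxE -!(derive_coord _ _ D).
rewrite (_ : (fun z => d1 v z j i) = - (fun z => d1 v z i j)).
  by rewrite deriveN //; exact: (derivable_mxP _ _ _).1.
apply/funext => z; have /matrixP /(_ i j) := d1_antisym v z.
by rewrite mxE => ->; rewrite mxE.
Qed.

(** Iterating Cartan's formula: the exact part [d (v.X)] of the first Lie
    derivative contributes [d (X (v.X))] because [d d = 0], and the other part
    is annihilated by [X]. *)
Lemma lie_form_twice X v q :
  let f z := dot (X z) (v z) in
  (\forall z \near q, differentiable X z) ->
  (\forall z \near q, differentiable v z) ->
  (\forall z \near q, differentiable f z) ->
  differentiable (d1 v) q -> differentiable (d0 f) q ->
  forall u,
  dot (lie_form X (lie_form X v) q) u
  = dot ('D_(X q) X q *m d1 v q) u + dot (X q *m 'D_(X q) (d1 v) q) u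
    - dot ('D_u X q *m d1 v q) (X q)
    + dot u (d0 (fun z => dot (X z) (d0 f z)) q).
Proof.
move=> f dX dv df dd ddf u.
have dXq := nbhs_singleton dX.
pose eta z := X z *m d1 v z.
have deta : differentiable eta q := differentiable_mulmx dXq dd.
have E : \forall z \near q, lie_form X v z = eta z + d0 f z.
  by apply: filterS2 dX dv => z dXz dvz; exact: cartan.
have Lq : lie_form X (lie_form X v) q = lie_form X eta q + lie_form X (d0 f) q.
  rewrite lie_formE (jac_near E) (nbhs_singleton E) jacD // !lie_formE.
  by rewrite mulmxDr mulmxDl addrACA.
have D h : 'D_h eta q = 'D_h X q *m d1 v q + X q *m 'D_h (d1 v) q.
  have [_ ->] := is_derive_mulmx (derivableP (diff_derivable dXq (v := h)))
    (derivableP (diff_derivable dd (v := h))).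
  by [].
have z0 : d0 (fun z => dot (X z) (eta z)) q = 0.
  rewrite (_ : (fun _ => _) = fun=> 0).
    by apply/rowP => i; rewrite !mxE /partial derive_cst.
  by apply/funext => z; rewrite dotC dot_antisym0 // d1_antisym.
rewrite Lq (cartan dXq deta) (cartan dXq ddf) z0 addr0 (d1_d0 df ddf).
rewrite mulmx0 add0r dotDl [X in _ + X]dotC; congr (_ + _).
have S : dot (X q *m d1 eta q) u
    = dot ('D_(X q) eta q) u - dot ('D_u eta q) (X q).
  by rewrite (derive_jac _ deta) (derive_jac u deta) d1E dot_skew.
have K (p1 p2 r1 r2 x : 'rV[R]_n) : dot r2 x = 0 ->
    dot (p1 + p2) u - dot (r1 + r2) x = dot p1 u + dot p2 u - dot r1 x.
  by move=> r0; rewrite !dotDl r0 addr0.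
apply: etrans S (etrans (congr2 (fun p r => dot p u - dot r (X q))
  (D (X q)) (D u)) (K _ _ _ _ _ _)).
exact: dot_antisym0 (d1_derive_antisym u dd).
Qed.

End LieForms.

Section Identity.
Context {R : realType}.
Variables (I : set R) (a b : R -> R).
Hypotheses (oI : open I) (itvI : is_interval I).
Hypotheses (sa : smooth I a) (sb : smooth I b).
Hypothesis apos : forall t, I t -> 0 < a t.
Hypothesis det : forall t, I t -> b t * derive1 a t - a t * derive1 b t != 0.
Hypothesis us : unit_speed I a b.
Variables (U : set 'rV[R]_3) (v : 'rV[R]_3 -> 'rV[R]_3).
Hypotheses (oU : open U) (sv : smooth U v).
Hypothesis hdiv : forall q, U q -> divergence euclid v q = 0.

Local Notation X := (chart a b).
Local Notation T := (meridian a b).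
Local Notation E := (@parallel R).
Local Notation N := (Nfield I a b).
Local Notation nu := (grad_norm I a b).
Local Notation C := (cone I a b).

Hypothesis vn : forall y : 'rV[R]_2, I (y 0 0) -> U (X y) ->
  dot (v (X y)) (normal a b y) = 0.
Hypothesis divS : forall y : 'rV[R]_2, I (y 0 0) -> U (X y) ->
  divergence (induced_metric X) (sharp (induced_metric X) (pullback X v)) y = 0.

Let oC : open C. Proof. exact: open_cone. Qed.

Variable y : 'rV[R]_2.
Hypotheses (Iy : I (y 0 0)) (Uy : U (X y)).
Let q := X y.

Let Cy : C q. Proof. exact: cone_chart. Qed.
Let fr : orthonormal3 (T y) (E y) (N q). Proof. exact: frame_chart. Qed.
Let a0 : a (y 0 0) != 0. Proof. by rewrite gt_eqF // apos. Qed.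
Let dd : differentiable (d1 v) q.
Proof. exact: smooth_diff (smooth_d1 oU sv) Uy. Qed.
Let nearX := near_chart oI sa sb oU Iy Uy.

(** In the frame of [S], the derivative of [d v] along [N] is separated from the
    tangential ones, which the surface Laplacian contains as well. *)
Lemma hodge_space u : dot (hodge_laplacian euclid v q) u
  = - (dot (T y *m 'D_(T y) (d1 v) q) u + dot (E y *m 'D_(E y) (d1 v) q) u
       + dot (N q *m 'D_(N q) (d1 v) q) u).
Proof.
rewrite hodge_euclid //; last first.
  by apply: filterS (open_near oU Uy) => z; exact: hdiv.
have -> : \sum_i (delta_mx 0 i : 'rV[R]_3) *m 'D_(delta_mx 0 i) (d1 v) q
    = \sum_i (delta_mx 0 i : 'rV[R]_3) *m 'd (d1 v) q (delta_mx 0 i).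
  by apply: eq_bigr => i _; rewrite (deriveE _ dd).
by rewrite (trace_frame3 _ fr) -!(deriveE _ dd) dotNl !dotDl.
Qed.

Section Curved.
Variables k1 k2 : R.
Hypothesis hk1 : 'D_(T y) N q = - k1 *: T y.
Hypothesis hk2 : 'D_(E y) N q = - k2 *: E y.

Let B z := dot (T z *m d1 v (X z)) (E z).

Let near_beta : \forall z \near y, d1 (pullback X v) z 0 1 / a (z 0 0) = B z.
Proof.
apply: filterS nearX => z [Iz Uz].
have dX : \forall x \near z, differentiable X x.
  apply: filterS (near_chart_mem oI Iz) => x Ix.
  by have := differentiable_chart sa sb Ix.
have ddX k : differentiable ('D_(delta_mx 0 k) X) z.
  move: k; apply: forall_ord2.
    apply: near_eq_differentiable (differentiable_meridian sa sb Iz).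
    apply: filterS (near_chart_mem oI Iz) => x Ix.
    by rewrite (chart_dt sa sb Ix).
  have D : differentiable (fun x : 'rV[R]_2 => (a (x 0 0))%:M *m E x) z.
    apply: differentiable_mulmx (@differentiable_parallel R z).
    apply/differentiable_mxP => i j; rewrite !ord1.
    rewrite (_ : (fun _ => _) = fun x : 'rV[R]_2 => a (x 0 0)).
      exact: differentiable_entry_comp (smooth_diff sa Iz).
    by apply/funext => x; rewrite mxE eqxx mulr1n.
  apply: near_eq_differentiable D.
  apply: filterS (near_chart_mem oI Iz) => x Ix.
  by rewrite (chart_dtheta sa sb Ix) mul_scalar_mx.
rewrite (d1_pullback 0 1 dX ddX (smooth_diff sv Uz)).
rewrite (chart_dt sa sb Iz) (chart_dtheta sa sb Iz) dotZr mulrC mulKf //.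
by rewrite gt_eqF // apos.
Qed.

(** The surface Laplacian differentiates the single function [d v (T, E)]; the
    frame turns, which leaves the curvatures. *)
Lemma hodge_surface :
  hodge_laplacian (induced_metric X) (pullback X v) y 0 0
    = dot (T y *m 'D_(E y) (d1 v) q) (E y) + k2 * dot (T y *m d1 v q) (N q) /\
  hodge_laplacian (induced_metric X) (pullback X v) y 0 1
    = - (a (y 0 0) * (k1 * dot (N q *m d1 v q) (E y)
                      + dot (T y *m 'D_(T y) (d1 v) q) (E y))).
Proof.
have dX := differentiable_chart sa sb Iy.
have dT := differentiable_meridian sa sb Iy.
have dE := @differentiable_parallel R y.
have dw : differentiable (d1 v \o X) y := differentiable_comp dX dd.
have dB : differentiable B y.
  exact: differentiable_dot (differentiable_mulmx dT dw) dE.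
have dbeta : differentiable
    (fun z : 'rV[R]_2 => d1 (pullback X v) z 0 1 / a (z 0 0)) y.
  apply: near_eq_differentiable dB; apply: filterS near_beta => z; exact: esym.
have nd : \forall z \near y,
    divergence (induced_metric X) (sharp (induced_metric X) (pullback X v)) z = 0.
  by apply: filterS nearX => z [Iz Uz]; exact: divS.
have [H0 H1] := hodge_warped (near_warped oI sa sb apos us Iy) nd dbeta.
have [W0 W1] := derive_chart sa sb Iy dd.
have D h := is_derive_dot_mulmx (derivableP (diff_derivable dT (v := h)))
  (derivableP (diff_derivable dw (v := h))) (derivableP (diff_derivable dE (v := h))).
have anti := d1_antisym v q.
have P0 : partial 0 (fun z : 'rV[R]_2 => d1 (pullback X v) z 0 1 / a (z 0 0)) y
    = k1 * dot (N q *m d1 v q) (E y) + dot (T y *m 'D_(T y) (d1 v) q) (E y).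
  rewrite /partial (near_eq_derive _ near_beta).
  have [_ ->] := D (delta_mx 0 0).
  rewrite W0 (meridian_curvature oI itvI sa sb apos det us Iy hk1).
  by rewrite parallel_dt dot0r addr0 -scalemxAl dotZl.
have P1 : partial 1 (fun z : 'rV[R]_2 => d1 (pullback X v) z 0 1 / a (z 0 0)) y
    = a (y 0 0) * (dot (T y *m 'D_(E y) (d1 v) q) (E y)
                   + k2 * dot (T y *m d1 v q) (N q)).
  rewrite /partial (near_eq_derive _ near_beta).
  have [_ ->] := D (delta_mx 0 1).
  rewrite W1 (parallel_curvature oI itvI sa sb apos det us Iy hk2).
  rewrite (meridian_dtheta sa sb Iy) -scalemxAl -scalemxAr !dotZl dotDr.
  rewrite (dotZr (- _)) (dotZr (a _ * _) _ (N _)).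
  rewrite [dot (E y *m _) _](dot_antisym0 (E y) anti).
  rewrite [dot (T y *m _) (T y)](dot_antisym0 (T y) anti).
  by rewrite !mulr0 !add0r mulrDr mulrA.
split; last exact: etrans H1 (congr1 (fun t => - (a (y 0 0) * t)) P0).
exact: etrans H0 (etrans (congr1 (fun t => (a (y 0 0))^-1 * t) P1) (mulKf a0 _)).
Qed.

End Curved.

End Identity.

(** * Lie derivatives on the surface *)

Section LieOnSurface.
Context {R : realType}.
Variables (I : set R) (a b : R -> R).
Hypotheses (oI : open I) (itvI : is_interval I).
Hypotheses (sa : smooth I a) (sb : smooth I b).
Hypothesis apos : forall t, I t -> 0 < a t.
Hypothesis det : forall t, I t -> b t * derive1 a t - a t * derive1 b t != 0.
Hypothesis us : unit_speed I a b.
Variables (U : set 'rV[R]_3) (v : 'rV[R]_3 -> 'rV[R]_3).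
Hypotheses (oU : open U) (sv : smooth U v).
Hypothesis hdiv : forall q, U q -> divergence euclid v q = 0.

Local Notation X := (chart a b).
Local Notation T := (meridian a b).
Local Notation E := (@parallel R).
Local Notation N := (Nfield I a b).
Local Notation nu := (grad_norm I a b).
Local Notation C := (cone I a b).
Local Notation kap := (kappa I a b).
Local Notation f := (normal_part I a b v).
Local Notation G := (turning I a b v).

Hypothesis vn : forall y : 'rV[R]_2, I (y 0 0) -> U (X y) ->
  dot (v (X y)) (normal a b y) = 0.
Hypothesis divS : forall y : 'rV[R]_2, I (y 0 0) -> U (X y) ->
  divergence (induced_metric X) (sharp (induced_metric X) (pullback X v)) y = 0.

Let UC := U `&` C.
Let oC : open C. Proof. exact: open_cone. Qed.
Let oUC : open UC. Proof. exact: openI. Qed.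
Let svUC : smooth UC v. Proof. by move=> k; apply: Ck_sub (sv k) => z []. Qed.
Let sub (W : normedModType R) (F : 'rV[R]_3 -> W) : smooth C F -> smooth UC F.
Proof. by move=> sF k; apply: Ck_sub (sF k) => z []. Qed.
Let sN : smooth UC N. Proof. by apply: sub; exact: smooth_Nfield. Qed.
Let snu : smooth UC nu. Proof. by apply: sub; exact: smooth_grad_norm. Qed.
Let snuV : smooth UC (fun z => (nu z)^-1).
Proof. by apply: sub; exact: smooth_grad_norm_inv. Qed.
Let sE1 : smooth UC (E1 I a b). Proof. by apply: sub; exact: smooth_E1. Qed.
Let sE1nu : smooth UC (E1_grad_norm I a b).
Proof. by apply: sub; exact: smooth_E1_grad_norm. Qed.
Let sf : smooth UC f. Proof. exact: smooth_dot. Qed.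
Let sG : smooth UC G.
Proof.
move=> k; apply: CkM => //; last exact: smooth_dot.
exact: CkM.
Qed.

Variable y : 'rV[R]_2.
Hypotheses (Iy : I (y 0 0)) (Uy : U (X y)).
Let q := X y.

Let Cy : C q. Proof. exact: cone_chart. Qed.
Let UCq : UC q. Proof. by split. Qed.
Let fr : orthonormal3 (T y) (E y) (N q). Proof. exact: frame_chart. Qed.
Let apos_y : 0 < a (y 0 0). Proof. exact: apos. Qed.
Let nearX := near_chart oI sa sb oU Iy Uy.
Let nearUC : \forall z \near q, UC z. Proof. exact: open_near. Qed.
Let diffUC (W : normedModType R) (F : 'rV[R]_3 -> W) :
  smooth UC F -> \forall z \near q, differentiable F z.
Proof. by move=> sF; apply: filterS nearUC => z; exact: smooth_diff. Qed.
Let nuN0 : nu q != 0.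
Proof. by rewrite gt_eqF //; exact: nu_gt0. Qed.

Lemma tangential_derive (F H : 'rV[R]_3 -> R) u :
  differentiable F q -> differentiable H q ->
  (forall z : 'rV[R]_2, I (z 0 0) -> U (X z) -> F (X z) = H (X z)) ->
  u = T y \/ u = E y -> 'D_u F q = 'D_u H q.
Proof.
move=> dF dH FH.
have nFH : \forall z \near y, (F \o X) z = (H \o X) z.
  by apply: filterS nearX => z [Iz Uz]; exact: FH.
have [F0 F1] := derive_chart sa sb Iy dF.
have [H0 H1] := derive_chart sa sb Iy dH.
have Q0 := near_eq_derive (delta_mx 0 0) nFH.
have Q1 := near_eq_derive (delta_mx 0 1) nFH.
case=> ->; first exact: etrans (esym F0) (etrans Q0 H0).
apply: (scalerI (lt0r_neq0 apos_y)).
exact: etrans (esym F1) (etrans Q1 H1).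
Qed.

(** In Cartan's formula the exact part is the differential of the normal
    component of [v], which vanishes on [S]. *)
Lemma lie_normal u : u = T y \/ u = E y ->
  dot (lie_form N v q) u = dot (N q *m d1 v q) u.
Proof.
move=> tu; rewrite (cartan (smooth_diff sN UCq) (smooth_diff svUC UCq)) dotDl.
have df := smooth_diff sf UCq.
rewrite -[X in _ + X]dotC -[d0 _ q]/(d0 f q) -(derive_d0 u df).
rewrite (tangential_derive df (@differentiable_cst _ _ _ (0 : R) q) _ tu).
  by rewrite derive_cst addr0.
move=> z Iz Uz; rewrite /normal_part dotC.
exact: (dot_field_normal oI itvI sa sb apos det us vn Iz Uz).
Qed.

(** The term [d v (D_N N, u)] and the derivative of [turning] are the two that
    the Lie derivative along [Y] compensates. *)
Lemma lie_normal_twice u : u = T y \/ u = E y ->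
  dot (lie_form N (lie_form N v) q) u
  = kap q * dot (T y *m d1 v q) u + dot (N q *m 'D_(N q) (d1 v) q) u
    - dot ('D_u N q *m d1 v q) (N q) + 'D_u G q.
Proof.
move=> tu.
have sd1 := smooth_d1 oUC svUC; have sd0 := smooth_d0 oUC sf.
rewrite (lie_form_twice (diffUC sN) (diffUC svUC) (diffUC sf)
  (smooth_diff sd1 UCq) (smooth_diff sd0 UCq) u).
have DN : 'D_(N q) N q = kap q *: T y.
  exact: derive_normal_normal.
have sNf := smooth_dot oUC sN sd0.
have DG : dot u (d0 (fun z => dot (N z) (d0 f z)) q) = 'D_u G q.
  rewrite -(derive_d0 u (smooth_diff sNf UCq)).
  apply: tangential_derive (smooth_diff sNf UCq) (smooth_diff sG UCq) _ tu.
  by move=> z Iz Uz; exact: derive_normal_part.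
by rewrite [dot u (d0 _ q)]DG DN -scalemxAl dotZl.
Qed.

(** The field [Y] is [|grad rho| ^+ 2 * kappa] times the meridian field, and its
    product with [v] is [|grad rho| ^+ 2 * turning]: the factor in front has
    to be differentiated as well, whence the last term. *)
Lemma lie_Y u :
  dot (lie_form (Yfield I a b) v q) u
  = nu q ^+ 2 * (kap q * dot (T y *m d1 v q) u + 'D_u G q)
    + 2 * nu q * 'D_u nu q * G q.
Proof.
have sY : smooth UC (Yfield I a b).
  by apply: smooth_scale => // k; exact: CkM.
rewrite (cartan (smooth_diff sY UCq) (smooth_diff svUC UCq)) dotDl.
have dnu := smooth_diff snu UCq; have dG := smooth_diff sG UCq.
have YG : \forall z \near q, dot (Yfield I a b z) (v z) = nu z * nu z * G z.
  apply: filterS nearUC => z [Uz Cz].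
  have nz : nu z != 0 by rewrite gt_eqF //; exact: grad_norm_gt0.
  rewrite /Yfield dotZl /turning /kappa (dotC (v z)).
  by move: (dot _ _) => d; field.
have dYG : differentiable (fun z => nu z * nu z * G z) q.
  exact: differentiableM (differentiableM dnu dnu) dG.
rewrite (d0_near YG) [dot (d0 _ q) u]dotC -(derive_d0 u dYG).
have Hn := derivableP (diff_derivable dnu (v := u)).
have HG := derivableP (diff_derivable dG (v := u)).
have [_ ->] := is_derive_mul (is_derive_mul Hn Hn) HG.
have -> : Yfield I a b q = (nu q ^+ 2 * kap q) *: T y.
  rewrite /Yfield (E1_chart oI itvI sa sb apos det Iy); congr (_ *: _).
  by rewrite /kappa; field.
rewrite -scalemxAl dotZl.
by move: (dot _ _) ('D_u G q) ('D_u nu q) => d dg dn; ring.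
Qed.

Section Curved.
Variables k1 k2 : R.
Hypothesis hk1 : 'D_(T y) N q = - k1 *: T y.
Hypothesis hk2 : 'D_(E y) N q = - k2 *: E y.

Let anti := d1_antisym v q.
Let antiP u := d1_derive_antisym u (smooth_diff (smooth_d1 oU sv) Uy).

Lemma laplacian_identity_meridian :
  dot (hodge_laplacian euclid v q) (T y)
  = hodge_laplacian (induced_metric X) (pullback X v) y 0 0
    - dot (lie_form N (lie_form N v) q) (T y)
    + (k1 - k2) * dot (lie_form N v q) (T y)
    + (nu q ^+ 2)^-1 * dot (lie_form (Yfield I a b) v q) (T y)
    + 2 * (k2 - k1) * dot (lie_form N v q) (T y)
    - 2 * kap q ^+ 2 * dot (v q) (T y).
Proof.
have tT : T y = T y \/ T y = E y by left.
have Dnu : 'D_(T y) nu q = kap q * nu q.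
  apply: etrans (esym (divfK nuN0 _)).
  by rewrite -(E1_chart oI itvI sa sb apos det Iy).
have Gq : G q = kap q * dot (v q) (T y).
  by rewrite /turning (E1_chart oI itvI sa sb apos det Iy).
have [HS _] := hodge_surface oI itvI sa sb apos det us oU sv divS Iy Uy hk1 hk2.
have DN : dot ('D_(T y) N q *m d1 v q) (N q) = - k1 * dot (T y *m d1 v q) (N q).
  by rewrite hk1 -scalemxAl dotZl.
(* The identity is linear algebra in the values collected above; it is proved
   for scalars and then instantiated. *)
have K (h s l2 l1 ly tt et p n tw w wn dn dg g vT ka m dm : R) :
    h = - (tt + et + n) -> tt = 0 -> et = - p -> s = p + k2 * w ->
    l2 = ka * tw + n - dn + dg -> tw = 0 -> dn = - k1 * w ->
    l1 = wn -> wn = - w -> ly = m ^+ 2 * (ka * tw + dg) + 2 * m * dm * g ->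
    dm = ka * m -> g = ka * vT -> m != 0 ->
    h = s - l2 + (k1 - k2) * l1 + (m ^+ 2)^-1 * ly + 2 * (k2 - k1) * l1
        - 2 * ka ^+ 2 * vT.
  by do 12!move=> ->; move=> m0; field.
exact: K (hodge_space oI itvI sa sb apos det us oU sv hdiv Iy Uy (T y))
  (dot_antisym0 (T y) (antiP (T y))) (dot_antisym (E y) (T y) (antiP (E y))) HS
  (lie_normal_twice tT) (dot_antisym0 (T y) anti) DN (lie_normal tT)
  (dot_antisym (N q) (T y) anti) (lie_Y (T y)) Dnu Gq nuN0.
Qed.

Lemma laplacian_identity_parallel :
  a (y 0 0) * dot (hodge_laplacian euclid v q) (E y)
  = hodge_laplacian (induced_metric X) (pullback X v) y 0 1
    - a (y 0 0) * dot (lie_form N (lie_form N v) q) (E y)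
    + (k1 - k2) * (a (y 0 0) * dot (lie_form N v q) (E y))
    + (nu q ^+ 2)^-1 * (a (y 0 0) * dot (lie_form (Yfield I a b) v q) (E y)).
Proof.
have tE : E y = T y \/ E y = E y by right.
have [_ HS] := hodge_surface oI itvI sa sb apos det us oU sv divS Iy Uy hk1 hk2.
have DN : dot ('D_(E y) N q *m d1 v q) (N q) = - k2 * dot (E y *m d1 v q) (N q).
  by rewrite hk2 -scalemxAl dotZl.
have Dnu := derive_nu_parallel oI itvI sa sb apos det us Iy.
have K (A h s l2 l1 ly tt et n tw w wn dn dg g ka m dm : R) :
    h = - (tt + et + n) -> et = 0 -> s = - (A * (k1 * wn + tt)) ->
    l2 = ka * tw + n - dn + dg -> dn = - k2 * w -> w = - wn ->
    l1 = wn -> ly = m ^+ 2 * (ka * tw + dg) + 2 * m * dm * g ->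
    dm = 0 -> m != 0 ->
    A * h = s - A * l2 + (k1 - k2) * (A * l1) + (m ^+ 2)^-1 * (A * ly).
  by do 9!move=> ->; move=> m0; field.
exact: K (hodge_space oI itvI sa sb apos det us oU sv hdiv Iy Uy (E y))
  (dot_antisym0 (E y) (antiP (E y))) HS (lie_normal_twice tE) DN
  (dot_antisym (E y) (N q) anti) (lie_normal tE) (lie_Y (E y)) Dnu nuN0.
Qed.

End Curved.

End LieOnSurface.

(** * The identity *)

Lemma divergence_near (R : realType) n (g : 'rV[R]_n -> 'M[R]_n)
    (al be : 'rV[R]_n -> 'rV[R]_n) y : (\forall z \near y, al z = be z) ->
  divergence g (sharp g al) y = divergence g (sharp g be) y.
Proof.
move=> ab; rewrite /divergence; congr (_ * _); apply: eq_bigr => i _.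
by apply: near_eq_derive; apply: filterS ab => z abz; rewrite /sharp abz.
Qed.

Theorem theorem1p27 (R : realType) (C : set (R * R))
  (vS : 'rV[R]_3 -> 'rV[R]_3) (p : 'rV[R]_3)
  (U : set 'rV[R]_3) (v : 'rV[R]_3 -> 'rV[R]_3)
  (I : set R) (a b : R -> R) (t0 : R) (k1 k2 : 'rV[R]_3 -> R)
  (hC : embedded_curve C)
  (hT : transversal_lines (surface C))
  (hvS : surface_vector_field C vS)
  (hdivS : surface_divergence_free C vS)
  (hp : surface C p)
  (hU : open U) (hUp : U p)
  (hv : smooth U v)
  (hext : forall q, U q -> surface C q -> v q = vS q)
  (hdiv : forall q, U q -> divergence euclid v q = 0)
  (hI : local_param C I a b) (hab : unit_speed I a b)
  (ht0 : I t0) (hpt0 : profile p = (a t0, b t0))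
  (hk1 : \forall q \near p, surface C q ->
     shape_operator I a b q (E1 I a b q) = k1 q *: E1 I a b q)
  (hk2 : \forall q \near p, surface C q ->
     shape_operator I a b q (E2 I a b q) = k2 q *: E2 I a b q) :
  \forall q \near p, forall y : 'rV[R]_2, I (y 0 0) -> chart a b y = q ->
    let iS := chart a b in
    let w := flat euclid v in
    let LNw := lie_form (Nfield I a b) w in
    let E1d := pullback iS (flat euclid (E1 I a b)) in
    pullback iS (hodge_laplacian euclid w) y =
      hodge_laplacian (induced_metric iS) (pullback iS w) y
      - pullback iS (lie_form (Nfield I a b) LNw) y
      + (k1 q - k2 q) *: pullback iS LNw y
      + ((grad_norm I a b q) ^+ 2)^-1 *: pullback iS (lie_form (Yfield I a b) w) y
      + (2 * (k2 q - k1 q) * form_eval (LNw q) (E1 I a b q)) *: E1d y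
      - (2 * (E1_grad_norm I a b q / grad_norm I a b q) ^+ 2
           * form_eval (w q) (E1 I a b q)) *: E1d y.
Proof.
have [[oI itvI] [sa sb] _ _ _] := hI.
have Cpos : forall c, C c -> 0 < c.1 by case: hC.
have apos t : I t -> 0 < a t by exact: param_gt0 Cpos hI t.
have det t : I t -> b t * derive1 a t - a t * derive1 b t != 0.
  by move=> It; exact: (transversal_det Cpos hI hab hT It).
have vn (y : 'rV[R]_2) : I (y 0 0) -> U (chart a b y) ->
    dot (v (chart a b y)) (normal a b y) = 0.
  move=> Iy Uy; have Sy := surface_chart Cpos hI Iy.
  have [tv _] := hvS; rewrite hext //.
  exact: (tangent_normal Cpos hI hab Iy (tv _ Sy)).
have divS (y : 'rV[R]_2) : I (y 0 0) -> U (chart a b y) ->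
    let g := induced_metric (chart a b) in
    divergence g (sharp g (pullback (chart a b) v)) y = 0.
  move=> Iy Uy g; rewrite -(hdivS I a b hI y Iy) flat_euclid.
  apply: divergence_near; apply: filterS (near_chart oI sa sb hU Iy Uy).
  move=> z [Iz Uz]; apply/rowP => i; rewrite !mxE.
  by rewrite (hext _ Uz (surface_chart Cpos hI Iz)).
apply: filterS3 (open_near hU hUp) hk1 hk2 => q Uq K1 K2 y Iy yq; subst q.
have Sy := surface_chart Cpos hI Iy.
have E1y := E1_chart oI itvI sa sb apos det Iy.
have E2y := E2_chart oI itvI sa sb apos det Iy.
move: (K1 Sy) (K2 Sy); rewrite /shape_operator E1y E2y => {}K1 {}K2.
have {}K1 : 'D_(meridian a b y) (Nfield I a b) (chart a b y)
    = - k1 (chart a b y) *: meridian a b y by rewrite scaleNr -K1 opprK.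
have {}K2 : 'D_(parallel y) (Nfield I a b) (chart a b y)
    = - k2 (chart a b y) *: parallel y by rewrite scaleNr -K2 opprK.
have F0 := laplacian_identity_meridian oI itvI sa sb apos det hab hU hv hdiv vn
  divS Iy Uq K1 K2.
have F1 := laplacian_identity_parallel oI itvI sa sb apos det hab hU hv hdiv vn
  divS Iy Uq K1 K2.
have [TT _ _ [TE _ _]] := frame_chart oI itvI sa sb apos det hab Iy.
(* Since [E1] is the meridian field on [S], its form is [dt] in the chart. *)
rewrite /= !flat_euclid.
have K (A B Cc D F : 'rV[R]_2) (c1 c2 c3 c4 : R) i :
    (A - B + c1 *: Cc + c2 *: D + c3 *: F - c4 *: F) 0 i
    = A 0 i - B 0 i + c1 * Cc 0 i + c2 * D 0 i + c3 * F 0 i - c4 * F 0 i.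
  by rewrite !mxE.
have P w := pullback_chart sa sb Iy w.
apply/rowP; apply: forall_ord2; rewrite K.
  rewrite !(fun w => (P w).1) E1y TT !mulr1.
  exact: F0.
rewrite !(fun w => (P w).2) E1y TE !mulr0 addr0 subr0.
exact: F1.
Qed.
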